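(* Let $p=p(n)$ and $G\in\mathcal G(n,p)$. If $p=\omega(n^{-3/2})$ and $p\le\sqrt{\frac{\log n}{25n}}$, then with high probability $G$ is not reconstructible from its $1$-neighbourhoods.
   Context: $\mathcal G(n,p)$ is the Erdős–Rényi random graph on vertex set $[n]$ in which each pair is an edge independently with probability $p$. ''With high probability'' means with probability tending to $1$ as $n\to\infty$. For a graph $G$, a vertex $v$ and an integer $r\ge1$, the $r$-neighbourhood $N_r^{(G)}(v)$ is the subgraph of $G$ induced by the vertices at distance at most $r$ from $v$, considered as a graph rooted at $v$. Graphs $G$ and $H$ have isomorphic $r$-neighbourhoods if there is a bijection $\phi:V(G)\to V(H)$ such that for every $v\in V(G)$ there is a graph isomorphism $N_r^{(G)}(v)\to N_r^{(H)}(\phi(v))$ mapping $v$ to $\phi(v)$. $G$ is reconstructible from its $r$-neighbourhoods if every graph $H$ with $r$-neighbourhoods isomorphic to those of $G$ is isomorphic to $G$. *)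

(* Defs.v *)
From HB Require Import structures.
From mathcomp Require Import all_boot all_order all_algebra.
From mathcomp Require Import all_classical all_reals all_analysis.
From mathcomp Require Import fingroup perm.
Set Implicit Arguments. Unset Strict Implicit. Unset Printing Implicit Defensive.
Import Order.TTheory GRing.Theory Num.Theory.

Definition pairs (n : nat) : {set {set 'I_n}} := [set A : {set 'I_n} | #|A| == 2].

Definition graph (n : nat) := {set {set 'I_n}}.

Definition is_graph n (E : graph n) : bool := E \subset pairs n.

Definition adj n (E : graph n) (u w : 'I_n) : bool := (u != w) && ([set u; w] \in E).

Fixpoint ball n (E : graph n) (v : 'I_n) (r : nat) : {set 'I_n} :=
  match r with
  | 0 => [set v]
  | r'.+1 => ball E v r' :|: [set w | [exists u in ball E v r', adj E u w]]
  end.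

Definition rooted_nbhd_iso n (r : nat) (G H : graph n) (v v' : 'I_n) : Prop :=
  exists f : 'I_n -> 'I_n,
    [/\ f v = v',
        {in ball G v r &, injective f},
        f @: ball G v r = ball H v' r &
        {in ball G v r &, forall x y, adj G x y = adj H (f x) (f y)}].

Definition same_nbhds n (r : nat) (G H : graph n) : Prop :=
  exists phi : {perm 'I_n}, forall v, rooted_nbhd_iso r G H v (phi v).

Definition graph_iso n (G H : graph n) : Prop :=
  exists s : {perm 'I_n}, forall x y, adj G x y = adj H (s x) (s y).

(* G is reconstructible from its r-neighbourhoods.  Every graph with the same
   number of vertices is isomorphic to one on 'I_n, so it suffices to
   quantify over graphs H on 'I_n. *)
Definition reconstructible n (r : nat) (G : graph n) : Prop :=
  forall H : graph n, is_graph H -> same_nbhds r G H -> graph_iso G H.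

Definition gnp_prob (R : realType) (n : nat) (p : R) (P : graph n -> Prop) : R :=
  \sum_(E : graph n | is_graph E && `[< P E >])
     (p ^+ #|E| * (1 - p) ^+ (#|pairs n| - #|E|))%R.

(* Main.v *)
(* Switching edges ab, cd to ad, bc preserves all 1-neighbourhoods when none of
   the pairs ab, cd, ad, bc has a common neighbour, and it changes the sum of
   deg x * deg y over all edges xy by (deg a - deg c)(deg d - deg b).  If
   deg a <> deg b and deg c <> deg d, then this is nonzero for ab, cd or after
   exchanging c and d.
   To find such edges, fix a vertex set U of size about min(n/2, 1/(4p)) and
   let W be its complement.  By Chebyshev, G[U] has of the order of |U|^2 p
   isolated edges.  Given G[U], the edges from different isolated edges to W
   are independent.  Among half of the isolated edges look for an edge ab
   without common neighbours in W, with deg a + deg b odd and with at most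
   about 5|W|p neighbours in W; among the other half look for an edge cd that
   moreover has no neighbour in common with ab.  One trial succeeds with
   probability at least of the order of min(1, np) exp(-11 n p^2), and since
   11/25 < 1/2 there are enough trials for p^2 <= log n / (25 n). *)
Require Import Defs.
From mathcomp Require Import all_boot all_order all_algebra.
From mathcomp Require Import all_classical all_reals all_analysis.
From mathcomp Require Import fingroup perm.
From mathcomp Require Import zify ring lra.
Set Implicit Arguments. Unset Strict Implicit. Unset Printing Implicit Defensive.
Import Order.TTheory GRing.Theory Num.Theory.
Import numFieldNormedType.Exports.
Local Open Scope ring_scope.

(** * Switching two edges *)

Definition nbhd n (E : graph n) (v : 'I_n) : {set 'I_n} := [set w | adj E v w].

(** The second Zagreb index, the isomorphism invariant that will tell a graph from its switched
    version. *)
Definition edge_degree_sum n (E : graph n) : nat :=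
  (\sum_(s in E) \prod_(x in s) #|nbhd E x|)%N.

Lemma adjC n (E : graph n) x y : adj E x y = adj E y x.
Proof. by rewrite /adj eq_sym finset.setUC. Qed.

Lemma adjxx n (E : graph n) x : adj E x x = false.
Proof. by rewrite /adj eqxx. Qed.

Lemma ball1E n (E : graph n) v w : (w \in Defs.ball E v 1) = (w == v) || adj E v w.
Proof.
rewrite /= !inE; congr (_ || _).
apply/existsP/idP => [[u /andP[/set1P-> //]]|vw].
by exists v; rewrite set11.
Qed.

Lemma graph_edgeP n (E : graph n) s : is_graph E -> s \in E ->
  exists a b, s = [set a; b] /\ a != b.
Proof.
move=> /fintype.subsetP sE /sE; rewrite inE => /cards2P[a [b [ab ->]]].
by exists a, b.
Qed.

(** [adj] only sees members that are pairs, so [is_graph] on both sides is what turns a bijection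
    preserving [adj] into one between edge sets. *)
Lemma graph_iso_edge_degree_sum n (G H : graph n) :
  is_graph G -> is_graph H -> graph_iso G H ->
  edge_degree_sum G = edge_degree_sum H.
Proof.
move=> gG gH [f fP].
have deg x : #|nbhd H (f x)| = #|nbhd G x|.
  rewrite -(card_imset (nbhd G x) (@perm_inj _ f)).
  apply: eq_card => y; rewrite !inE.
  apply/idP/imsetP => [Hy|[z + ->]]; last by rewrite inE fP.
  by exists (f^-1 y)%g; rewrite ?permKV// inE fP permKV.
have im2 x y : f @: [set x; y] = [set f x; f y].
  by rewrite imsetU1 imset_set1.
have imE (s : {set 'I_n}) : (f @: s \in H) = (s \in G).
  apply/idP/idP.
    move=> /[dup] /(graph_edgeP gH)[a [b [fs ab]]].
    have sE : s = [set (f^-1 a)%g; (f^-1 b)%g].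
      by apply: (imset_inj (@perm_inj _ f)); rewrite im2 !permKV.
    rewrite sE im2 !permKV => abH.
    have : adj H a b by rewrite /adj ab.
    by rewrite -{1}(permKV f a) -{1}(permKV f b) -fP => /andP[].
  move=> /[dup] /(graph_edgeP gG)[a [b [-> ab]]].
  rewrite im2 => abG; have : adj G a b by rewrite /adj ab.
  by rewrite fP => /andP[].
rewrite /edge_degree_sum [RHS](reindex_inj (imset_inj (@perm_inj _ f))).
apply: eq_big => [s|s _]; first by rewrite imE.
rewrite big_imset /=; last by move=> ? ? _ _; exact: perm_inj.
by apply: eq_bigr => x _; rewrite deg.
Qed.

Definition switch n (G : graph n) (a b c d : 'I_n) : graph n :=
  [set a; d] |: ([set b; c] |: (G :\ [set a; b]) :\ [set c; d]).

(** The last clause runs over the four pairs whose adjacency the switch changes. *)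
Definition switchable n (G : graph n) (a b c d : 'I_n) : Prop :=
  [/\ [/\ adj G a b, adj G c d, ~~ adj G a d & ~~ adj G b c],
      [/\ a != d, b != c, a != c & b != d] &
      forall w, [/\ ~~ (adj G a w && adj G b w), ~~ (adj G c w && adj G d w),
                    ~~ (adj G a w && adj G d w) & ~~ (adj G b w && adj G c w)]].

(** This symmetry and the next act transitively on the four ends, so only the neighbourhood of [a]
    has to be examined by hand. *)
Lemma switchable_sym1 n (G : graph n) a b c d :
  switchable G a b c d -> switchable G b a d c.
Proof.
move=> [[ab cd ad bc] [nad nbc nac nbd] H]; split.
- by rewrite adjC ab adjC cd.
- by [].
- by move=> w; have [? ? ? ?] := H w; split=> //; rewrite andbC.
Qed.

Lemma switchable_sym2 n (G : graph n) a b c d :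
  switchable G a b c d -> switchable G c d a b.
Proof.
move=> [[ab cd ad bc] [nad nbc nac nbd] H]; split.
- by split=> //; rewrite adjC.
- by split; rewrite eq_sym.
- by move=> w; have [? ? ? ?] := H w; split=> //; rewrite andbC.
Qed.

Lemma set2_eqE n (x y a b : 'I_n) : a != b ->
  ([set x; y] == [set a; b]) =
  (x == a) && (y == b) || (x == b) && (y == a).
Proof.
move=> ab; apply/eqP/idP => [e|/orP[]/andP[/eqP-> /eqP->]//]; last first.
  by rewrite finset.setUC.
have /set2P[xE|xE] : x \in [set a; b] by rewrite -e finset.set21.
  have : b \in [set x; y] by rewrite e finset.set22.
  by rewrite !inE xE eq_sym (negbTE ab) /= eqxx eq_sym => ->.
have : a \in [set x; y] by rewrite e finset.set21.
by rewrite !inE xE (negbTE ab) /= eqxx eq_sym => ->; rewrite orbT.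
Qed.

Lemma switch_sym1 n (G : graph n) a b c d : switch G b a d c = switch G a b c d.
Proof.
by rewrite /switch ![[set b; _]]finset.setUC ![[set d; _]]finset.setUC
  finset.setUCA.
Qed.

Lemma switch_sym2 n (G : graph n) a b c d : switch G c d a b = switch G a b c d.
Proof.
apply/setP => s; rewrite /switch !inE ![[set c; b]]finset.setUC
  ![[set d; a]]finset.setUC.
rewrite [[set c; _]]finset.setUC [[set d; _]]finset.setUC.
by case: (s == _); case: (s == _); case: (s == _); case: (s == _).
Qed.

Lemma adj_switch n (G : graph n) a b c d x y : switchable G a b c d ->
  adj (switch G a b c d) x y =
  [|| (x == a) && (y == d) || (x == d) && (y == a),
      (x == b) && (y == c) || (x == c) && (y == b) |
      [&& adj G x y, ~~ ((x == a) && (y == b) || (x == b) && (y == a)) &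
          ~~ ((x == c) && (y == d) || (x == d) && (y == c))]].
Proof.
move=> [[ab cd _ _] [ad bc _ _] _].
rewrite /adj /switch !inE !set2_eqE//; [|by case/andP: ab|by case/andP: cd].
have neq (u v : 'I_n) : u != v -> (y == u) && (y == v) = false.
  by move=> uv; apply/negP => /andP[/eqP yu /eqP yv]; rewrite -yu -yv eqxx in uv.
have [->|xy] := eqVneq x y.
  by rewrite /= !neq// eq_sym.
rewrite /=; congr [|| _, _ | _].
by rewrite andbA andbC; congr (_ && _); rewrite andbC.
Qed.

Lemma adj_neq n (E : graph n) x y : adj E x y -> x != y.
Proof. by case/andP. Qed.

Lemma switchable_neqs n (G : graph n) a b c d : switchable G a b c d ->
  (((a == b) = false) * ((a == c) = false) * ((a == d) = false) *
   ((b == a) = false) * ((b == c) = false) * ((b == d) = false) *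
   ((c == a) = false) * ((c == b) = false) * ((c == d) = false) *
   ((d == a) = false) * ((d == b) = false) * ((d == c) = false))%type.
Proof.
move=> [[/adj_neq ab /adj_neq cd _ _] [ad bc ac bd] _].
by do !split; apply/negbTE; rewrite // eq_sym.
Qed.

(** The vertex [a] loses the neighbour [b] and gains [d], so the transposition of [b] and [d] is the
    isomorphism. Inside the ball of [a], the vertex [b] before the switch and [d] after it are
    adjacent to [a] alone, as neither [ab] nor [ad] has common neighbours. *)
Lemma rooted_nbhd_iso_switch_end n (G : graph n) a b c d : switchable G a b c d ->
  rooted_nbhd_iso 1 G (switch G a b c d) a a.
Proof.
move=> sw; have neqs := switchable_neqs sw.
case: (sw) => [[ab cd ad bc] _ co].
have [/= tb td] := (tpermL b d, tpermR b d).
have toth x : x != b -> x != d -> tperm b d x = x.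
  by move=> xb xd; rewrite tpermD// eq_sym.
exists (tperm b d); split.
- by rewrite toth ?neqs.
- by move=> x y _ _; exact: perm_inj.
- apply/setP => y; rewrite -{1}(tpermK b d y) mem_imset; last exact: perm_inj.
  rewrite !ball1E adj_switch//.
  have [->|yb] := eqVneq y b; first by rewrite tb !neqs !eqxx /= (negbTE ad) andbF.
  have [->|yd] := eqVneq y d; first by rewrite td !neqs !eqxx ab.
  rewrite toth// !neqs !(andbF, andbT, eqxx) ?(negbTE yb) ?(negbTE yd).
  by rewrite ?andbF ?andbT /= ?andbT ?andbF.
- move=> x y; rewrite !ball1E => xB yB.
  have nd z : (z == a) || adj G a z -> z != d.
    move=> /orP[/eqP->|az]; first by rewrite neqs.
    by apply: contraNneq ad => <-.
  (* Both sides hold exactly when [z] is [a]: any other [z] would be a common neighbour of [a] with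
     [b] or with [d]. *)
  have key z : (z == a) || adj G a z -> z != b ->
      adj G b z = adj (switch G a b c d) d z.
    move=> zB zb; rewrite adj_switch// !neqs !eqxx /= ?andbF ?orbF /=.
    have [->|za] := eqVneq z a; first by rewrite adjC ab.
    move: zB; rewrite (negbTE za) /= => az.
    have [/negbTE abz _ /negbTE adz _] := co z.
    by move: abz adz; rewrite az /= => -> ->.
  have [->|xb] := eqVneq x b; have [->|yb] := eqVneq y b; rewrite ?tb.
  + by rewrite !adjxx.
  + by rewrite toth ?nd// key.
  + by rewrite toth ?nd// adjC [RHS]adjC key.
  + rewrite !toth ?nd// adj_switch// (negbTE xb) (negbTE yb).
    by rewrite (negbTE (nd _ xB)) (negbTE (nd _ yB)) !andbF !andbT.
Qed.

(** Vertices other than the four ends keep their neighbours, and the identity works for them: a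
    changed pair inside such a neighbourhood would have the root as a common neighbour. *)
Lemma rooted_nbhd_iso_switch n (G : graph n) a b c d : switchable G a b c d ->
  forall v, rooted_nbhd_iso 1 G (switch G a b c d) v v.
Proof.
move=> sw v; have neqs := switchable_neqs sw.
have [->|va] := eqVneq v a; first exact: rooted_nbhd_iso_switch_end.
have [->|vb] := eqVneq v b.
  by rewrite -switch_sym1; apply/rooted_nbhd_iso_switch_end/switchable_sym1.
have [->|vc] := eqVneq v c.
  by rewrite -switch_sym2; apply/rooted_nbhd_iso_switch_end/switchable_sym2.
have [->|vd] := eqVneq v d.
  rewrite -switch_sym1 -switch_sym2.
  by apply/rooted_nbhd_iso_switch_end/switchable_sym2/switchable_sym1.
case: (sw) => [[ab cd ad bc] _ co].
have eqv w : adj (switch G a b c d) v w = adj G v w.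
  by rewrite adj_switch// (negbTE va) (negbTE vb) (negbTE vc) (negbTE vd) /= andbT.
exists id; split=> //.
- by rewrite imset_id; apply/setP => y; rewrite !ball1E eqv.
- move=> x y; rewrite !ball1E.
  move=> /orP[/eqP->|vx]; first by rewrite eqv.
  move=> /orP[/eqP->|vy]; first by rewrite adjC -eqv adjC.
  have [co1 co2 co3 co4] := co v.
  rewrite adj_switch//.
  have no u w : ~~ (adj G u v && adj G w v) ->
      (x == u) && (y == w) || (x == w) && (y == u) = false.
    move=> uw; apply: contraNF uw => /orP[]/andP[/eqP<- /eqP<-].
      by rewrite ![adj G _ v]adjC vx.
    by rewrite ![adj G _ v]adjC vx vy.
  by rewrite !no// !andbT.
Qed.

Lemma is_graph_switch n (G : graph n) a b c d : is_graph G ->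
  switchable G a b c d -> is_graph (switch G a b c d).
Proof.
move=> /fintype.subsetP gG [_ [ad bc _ _] _]; apply/fintype.subsetP => s.
rewrite /switch !inE => /or3P[/eqP->|/eqP->|/and3P[_ _ /gG]].
- by rewrite cards2 ad.
- by rewrite cards2 bc.
- by rewrite inE.
Qed.

Lemma card_nbhd_switch n (G : graph n) a b c d : switchable G a b c d ->
  forall v, #|nbhd (switch G a b c d) v| = #|nbhd G v|.
Proof.
move=> sw v; have [f [fv finj fim _]] := rooted_nbhd_iso_switch sw v.
have ballU (E : graph n) : Defs.ball E v 1 = v |: nbhd E v.
  by apply/setP => w; rewrite ball1E !inE.
have := card_in_imset finj; rewrite fim !ballU !cardsU1 !inE !adjxx /=.
by move=> [].
Qed.

(** Degrees are unchanged, so only the four switched pairs contribute to the difference. The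
    identity is additive because subtraction of natural numbers truncates. *)
Lemma edge_degree_sum_switch n (G : graph n) a b c d : switchable G a b c d ->
  (edge_degree_sum (switch G a b c d) +
     (#|nbhd G a| * #|nbhd G b| + #|nbhd G c| * #|nbhd G d|) =
   edge_degree_sum G +
     (#|nbhd G a| * #|nbhd G d| + #|nbhd G b| * #|nbhd G c|))%N.
Proof.
move=> sw; have neqs := switchable_neqs sw.
case: (sw) => [[/andP[nab ab] /andP[ncd cd] ad bc] _ _].
have adG : [set a; d] \notin G by move: ad; rewrite /adj neqs.
have bcG : [set b; c] \notin G by move: bc; rewrite /adj neqs.
have pr2 x y : x != y -> (\prod_(z in [set x; y]) #|nbhd G z| =
    #|nbhd G x| * #|nbhd G y|)%N.
  by move=> xy; rewrite big_setU1 ?inE//= big_set1.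
have -> : edge_degree_sum (switch G a b c d) =
    (\sum_(s in switch G a b c d) \prod_(x in s) #|nbhd G x|)%N.
  by apply: eq_bigr => s _; apply: eq_bigr => x _; rewrite card_nbhd_switch.
rewrite /edge_degree_sum /switch big_setU1 /=; last first.
  by rewrite !inE (negbTE adG) !andbF orbF set2_eqE ?neqs// !eqxx.
rewrite (big_setU1 [set b; c]) /=; last by rewrite !inE (negbTE bcG) !andbF.
rewrite [in RHS](big_setD1 _ ab) /= [in RHS](big_setD1 [set c; d]) /=; last first.
  by rewrite !inE cd andbT set2_eqE ?neqs.
rewrite !pr2 ?neqs//; ring.
Qed.

Lemma switchable_not_reconstructible n (G : graph n) a b c d : is_graph G ->
  switchable G a b c d -> #|nbhd G a| != #|nbhd G c| -> #|nbhd G b| != #|nbhd G d| ->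
  ~ reconstructible 1 G.
Proof.
move=> gG sw ac bd rec.
have gH := is_graph_switch gG sw.
have /(graph_iso_edge_degree_sum gG gH) e : graph_iso G (switch G a b c d).
  apply: rec => //; exists 1%g => v; rewrite perm1.
  exact: rooted_nbhd_iso_switch.
have := edge_degree_sum_switch sw; rewrite -e => /addnI e2.
(* The change of the invariant factors once it is written over the integers. *)
have : ((#|nbhd G a|%:Z - #|nbhd G c|%:Z) * (#|nbhd G b|%:Z - #|nbhd G d|%:Z) = 0)%R.
  by move: e2; clear; move: #|_| #|_| #|_| #|_| => x y z t; nia.
move=> /eqP; rewrite mulf_eq0 !subr_eq0 !eqz_nat.
by rewrite (negbTE ac) (negbTE bd).
Qed.

(* If both edges have ends of different degrees, then one of the two ways of
   switching them pairs up vertices of different degrees. *)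
Lemma two_switches_not_reconstructible n (G : graph n) a b c d : is_graph G ->
  switchable G a b c d -> switchable G a b d c ->
  #|nbhd G a| != #|nbhd G b| -> #|nbhd G c| != #|nbhd G d| ->
  ~ reconstructible 1 G.
Proof.
move=> gG sw1 sw2 ab cd.
have [e|ac] := eqVneq #|nbhd G a| #|nbhd G c|.
  by apply: (switchable_not_reconstructible gG sw2); rewrite ?e// -e eq_sym.
have [e|bd] := eqVneq #|nbhd G b| #|nbhd G d|.
  by apply: (switchable_not_reconstructible gG sw2); [rewrite -e|rewrite e eq_sym].
exact: (switchable_not_reconstructible gG sw1).
Qed.

(** * Isolated edges of an induced subgraph *)

(** For [w] outside [s] this is the number of neighbours of [w] in [s]. Testing membership in [E]
    makes it depend visibly on the pairs between [s] and [w] only. *)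
Definition cnt n (E : graph n) (s : {set 'I_n}) (w : 'I_n) : nat :=
  #|[set x in s | [set x; w] \in E]|.

(** For a graph [E] these are the single-edge components of the subgraph induced by [U]. *)
Definition isolated_edges n (U : {set 'I_n}) (E : graph n) : {set {set 'I_n}} :=
  [set s in E | (s \subset U) &&
    [forall t in E, (t \subset U) ==> (t != s) ==> [disjoint s & t]]].

(** For a pair [s], the boolean used as a bound makes two demands at once: no vertex of [W] sees
    both ends of [s], and no vertex of [Z] in [W] sees either end. [Z] will hold the outer
    neighbours of the edge found first. *)
Definition light_avoiding n (W Z s : {set 'I_n}) (E : graph n) : bool :=
  [forall w in W, cnt E s w <= (w \notin Z)]%N.

(* The oddness of the sum forces the two ends of an isolated edge [s] to have
   different degrees. *)
Definition light_odd_avoiding n (W Z s : {set 'I_n}) (E : graph n) : bool :=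
  light_avoiding W Z s E && odd (\sum_(w in W) cnt E s w).

Lemma cnt_set2 n (E : graph n) a b w : a != b ->
  cnt E [set a; b] w = (([set a; w] \in E) + ([set b; w] \in E))%N.
Proof.
move=> ab; rewrite /cnt -sum1dep_card big_mkcondr big_setU1 ?inE//= big_set1.
by do 2?case: ifP.
Qed.

Lemma isolated_edges_adj n (U : {set 'I_n}) (E : graph n) a b x :
  [set a; b] \in isolated_edges U E -> a != b -> x \in U -> adj E a x -> x = b.
Proof.
rewrite inE => /and3P[_ sU /'forall_implyP H] ab xU /andP[ax axE].
have aU : a \in U by apply: (fintype.subsetP sU); rewrite finset.set21.
have axU : [set a; x] \subset U.
  by apply/fintype.subsetP => y /set2P[->|->].
move: (H _ axE); rewrite axU /=.
have [e _|_] := eqVneq [set a; x] [set a; b].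
  have : x \in [set a; b] by rewrite -e finset.set22.
  by move=> /set2P[xa|//]; rewrite xa eqxx in ax.
by move=> /disjoint_setI0/setP/(_ a); rewrite !inE eqxx.
Qed.

(** A common neighbour in [U] contradicts isolation. In [W], lightness excludes one for the two ends
    of the same edge, and avoidance of [Z] excludes one for an end of [s] and an end of [t]. *)
Lemma isolated_edges_switchable n (U W Z s t : {set 'I_n}) (E : graph n) a b c d :
  W = (~: U) -> Z = [set w in W | 0 < cnt E s w]%N ->
  a != b -> c != d -> s = [set a; b] -> t = [set c; d] ->
  s \in isolated_edges U E -> t \in isolated_edges U E -> s != t ->
  light_avoiding W finset.set0 s E -> light_avoiding W Z t E ->
  switchable E a b c d.
Proof.
move=> WE ZE ab cd sE tE sI tI st /'forall_implyP ls /'forall_implyP lt.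
have adjW x w : x \in U -> w \in W -> ([set x; w] \in E) = adj E x w.
  by move=> xU; rewrite WE inE /adj; case: eqVneq => // <-; rewrite xU.
have [sEE sU] : s \in E /\ s \subset U by move: sI; rewrite inE => /and3P[].
have [tEE tU] : t \in E /\ t \subset U by move: tI; rewrite inE => /and3P[].
have stD : [disjoint s & t].
  move: sI; rewrite inE => /and3P[_ _ /'forall_implyP/(_ _ tEE)].
  by rewrite tU eq_sym st.
have [aU bU] : a \in U /\ b \in U.
  by split; apply: (fintype.subsetP sU); rewrite sE ?finset.set21 ?finset.set22.
have [cU dU] : c \in U /\ d \in U.
  by split; apply: (fintype.subsetP tU); rewrite tE ?finset.set21 ?finset.set22.
have stn x y : x \in s -> y \in t -> x != y.
  by move=> xs yt; apply: contraTneq yt => <-; rewrite (disjointFr stD xs).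
have [as_ bs] : a \in s /\ b \in s by rewrite sE finset.set21 finset.set22.
have [ct dt] : c \in t /\ d \in t by rewrite tE finset.set21 finset.set22.
have [sIab sIba] : [set a; b] \in isolated_edges U E /\ [set b; a] \in isolated_edges U E.
  by rewrite [[set b; a]]finset.setUC -sE.
have [tIcd tIdc] : [set c; d] \in isolated_edges U E /\ [set d; c] \in isolated_edges U E.
  by rewrite [[set d; c]]finset.setUC -tE.
have [ba dc] : b != a /\ d != c by split; rewrite eq_sym.
have adjs x y : x \in s -> y \in U -> adj E x y -> y \in s.
  rewrite sE => /set2P[->|->] yU.
    by move=> /(isolated_edges_adj sIab ab yU)->; rewrite finset.set22.
  by move=> /(isolated_edges_adj sIba ba yU)->; rewrite finset.set21.
have adjt x y : x \in t -> y \in U -> adj E x y -> y \in t.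
  rewrite tE => /set2P[->|->] yU.
    by move=> /(isolated_edges_adj tIcd cd yU)->; rewrite finset.set22.
  by move=> /(isolated_edges_adj tIdc dc yU)->; rewrite finset.set21.
have nst x y : x \in s -> y \in t -> ~~ adj E x y.
  move=> xs yt; apply/negP => /adjs; rewrite (fintype.subsetP tU)// => /(_ xs isT).
  by rewrite (disjointFl stD yt).
have WU w : (w \in W) = (w \notin U) by rewrite WE inE.
split.
- by split; rewrite ?nst// /adj ?ab ?cd -?sE -?tE.
- by rewrite !stn.
move=> w; have [wU|wU] := boolP (w \in U).
- have ns x y : x \in s -> y \in t -> ~~ (adj E x w && adj E y w).
    move=> xs yt; apply/negP => /andP[/adjs wx /adjt wy].
    by move: (wy yt wU); rewrite (disjointFr stD (wx xs wU)).
  split; [| |exact: ns|exact: ns].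
  + apply/negP => /andP[/(isolated_edges_adj sIab ab wU)->].
    by rewrite adjxx.
  + apply/negP => /andP[/(isolated_edges_adj tIcd cd wU)->].
    by rewrite adjxx.
- rewrite -WU in wU.
  move: (ls _ wU) (lt _ wU); rewrite ZE !inE wU /= sE tE !cnt_set2// !adjW//.
  by case: (adj E a w); case: (adj E b w); case: (adj E c w); case: (adj E d w).
Qed.

(** Each end has just the other one as neighbour in [U], so the two degrees are one plus the numbers
    of neighbours in [W], and the sum of those numbers is odd. *)
Lemma isolated_edges_degree_neq n (U W : {set 'I_n}) (E : graph n) a b :
  W = (~: U) -> a != b -> [set a; b] \in isolated_edges U E ->
  odd (\sum_(w in W) cnt E [set a; b] w) -> #|nbhd E a| != #|nbhd E b|.
Proof.
move=> WE ab sI.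
have [sEE sU] : [set a; b] \in E /\ [set a; b] \subset U.
  by move: sI; rewrite inE => /and3P[].
have deg x y : [set x; y] \in isolated_edges U E -> x != y ->
    #|nbhd E x| = (\sum_(w in W) ([set x; w] \in E)).+1.
  move=> xyI xy.
  have [xyE xyU] : [set x; y] \in E /\ [set x; y] \subset U.
    by move: xyI; rewrite inE => /and3P[].
  have xU : x \in U by apply: (fintype.subsetP xyU); rewrite finset.set21.
  have yU : y \in U by apply: (fintype.subsetP xyU); rewrite finset.set22.
  have -> : nbhd E x = y |: [set w in W | [set x; w] \in E].
    apply/setP => w; rewrite !inE WE inE.
    have [->|wy] := eqVneq w y; first by rewrite /adj xy xyE.
    have [wU|wU] := boolP (w \in U); last first.
      by rewrite /adj; case: eqVneq => // e; rewrite -e xU in wU.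
    by apply/negP => /(isolated_edges_adj xyI xy wU)/eqP; apply/negP.
  by rewrite cardsU1 !inE WE inE yU /= -sum1dep_card big_mkcondr; congr _.+1;
    apply: eq_bigr => w _; case: (_ \in _).
rewrite (deg a b)// (deg b a) ?(eq_sym b)//; last by rewrite finset.setUC.
rewrite (eq_bigr _ (fun w _ => cnt_set2 E w ab)) big_split /= oddD eqSS.
by case: eqVneq => // ->; rewrite addbb.
Qed.

(** The conditions see [t] as a set, so they hold for both orientations of its edge, as the two
    switchings require. *)
Lemma light_odd_not_reconstructible n (U s t : {set 'I_n}) (E : graph n) :
  is_graph E -> s \in isolated_edges U E -> t \in isolated_edges U E -> s != t ->
  light_odd_avoiding (~: U) finset.set0 s E ->
  light_odd_avoiding (~: U) [set w in (~: U) | 0 < cnt E s w]%N t E ->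
  ~ reconstructible 1 E.
Proof.
move=> gE sI tI st /andP[ls os] /andP[lt ot].
have [a [b [sE ab]]] : exists a b, s = [set a; b] /\ a != b.
  by apply: (graph_edgeP gE); move: sI; rewrite inE => /and3P[].
have [c [d [tE cd]]] : exists a b, t = [set a; b] /\ a != b.
  by apply: (graph_edgeP gE); move: tI; rewrite inE => /and3P[].
apply: (@two_switches_not_reconstructible _ _ a b c d) => //.
- by apply: (isolated_edges_switchable (U:=U) erefl erefl ab cd sE tE).
- rewrite eq_sym in cd; have tE' : t = [set d; c] by rewrite finset.setUC.
  by apply: (isolated_edges_switchable (U:=U) erefl erefl ab cd sE tE').
- by apply: (isolated_edges_degree_neq (U:=U)) => //; rewrite -sE.
- by apply: (isolated_edges_degree_neq (U:=U)) => //; rewrite -tE.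
Qed.

(** * Expectations over random subsets *)

(** Expectation over a random subset of [D] that keeps each element independently with probability
    [p]. As a finite sum over subsets it matches [gnp_prob] for [D := pairs n], and a general [D]
    allows the pairs to be exposed block by block. *)
Definition expect (R : realFieldType) (T : finType) (p : R) (D : {set T})
    (f : {set T} -> R) : R :=
  \sum_(E : {set T} | E \subset D) p ^+ #|E| * (1 - p) ^+ (#|D| - #|E|) * f E.

Lemma eq_expect (R : realFieldType) (T : finType) (p : R) (D : {set T}) f g :
  (forall E : {set T}, E \subset D -> f E = g E) -> expect p D f = expect p D g.
Proof. by move=> fg; apply: eq_bigr => E ED; rewrite fg. Qed.

Lemma le_expect (R : realFieldType) (T : finType) (p : R) (D : {set T}) f g :
  0 <= p <= 1 -> (forall E : {set T}, E \subset D -> f E <= g E) ->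
  expect p D f <= expect p D g.
Proof.
move=> /andP[p0 p1] fg; apply: ler_sum => E ED; apply: ler_wpM2l; last exact: fg.
by rewrite mulr_ge0 // exprn_ge0 // subr_ge0.
Qed.

(** Independence in the form of Fubini's theorem: a subset of [D] is a subset of [A] together with
    one of the complement, and its weight factorises. *)
Lemma expect_split (R : realFieldType) (T : finType) (p : R) (A D : {set T}) f :
  A \subset D ->
  expect p D f =
  expect p A (fun E1 => expect p (D :\: A) (fun E2 => f (E1 :|: E2))).
Proof.
move=> AD; rewrite /expect.
rewrite (partition_big (fun E : {set T} => E :&: A) (fun E1 => E1 \subset A)) /=;
  last by move=> E _; exact: subsetIr.
apply: eq_bigr => E1 E1A; rewrite mulr_sumr.
rewrite (reindex_onto (fun E2 => E1 :|: E2) (fun E => E :\: A)) /=; last first.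
  by move=> E /andP[_ /eqP<-]; rewrite finset.setID.
apply: eq_big => [E2|E2 /andP[/andP[E12 _] /eqP e]].
  apply/andP/idP => [[/andP[E12 _] /eqP<-]|E2D].
    by rewrite finset.setSD.
  have E2A : [disjoint E2 & A].
    by move: E2D; rewrite subsetD => /andP[].
  split; [apply/andP; split|].
  - rewrite finset.subUset (fintype.subset_trans E1A AD).
    by rewrite (fintype.subset_trans E2D)// finset.subsetDl.
  - rewrite finset.setIUl (disjoint_setI0 E2A) finset.setU0; apply/eqP.
    exact/finset.setIidPl.
  - rewrite finset.setDUl; move: E1A; rewrite -finset.setD_eq0 => /eqP->.
    by rewrite finset.set0U; apply/eqP/finset.setDidPl.
have E2D : E2 \subset D :\: A by rewrite -e finset.setSD.
have E2A : [disjoint E2 & A] by move: E2D; rewrite subsetD => /andP[].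
have dis : [disjoint E1 & E2] by rewrite disjoint_sym (disjointWr E1A).
rewrite cardsU (disjoint_setI0 dis) cards0 subn0 cardsD.
have -> : D :&: A = A by apply/finset.setIidPr.
have E1c := subset_leq_card E1A; have Ac := subset_leq_card AD.
have := subset_leq_card E2D; rewrite cardsD.
have -> : D :&: A = A by apply/finset.setIidPr.
move=> E2c.
have -> : (#|D| - (#|E1| + #|E2|) = (#|A| - #|E1|) + (#|D| - #|A| - #|E2|))%N by lia.
by rewrite !exprD; ring.
Qed.

Lemma expect0 (R : realFieldType) (T : finType) (p : R) f :
  expect p (finset.set0 : {set T}) f = f finset.set0.
Proof.
rewrite /expect (eq_bigl (pred1 finset.set0)); last by move=> E; rewrite finset.subset0.
by rewrite big_pred1_eq cards0 !expr0 !mul1r.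
Qed.

Lemma expect1 (R : realFieldType) (T : finType) (p : R) (x : T) f :
  expect p [set x] f = p * f [set x] + (1 - p) * f finset.set0.
Proof.
have x0 : [set x] != finset.set0 :> {set T} by apply/set0Pn; exists x; rewrite set11.
rewrite /expect (bigD1 [set x]) //= (bigD1 finset.set0) /=; last first.
  by rewrite finset.sub0set eq_sym.
rewrite big1 ?addr0; last first.
  by move=> E /andP[/andP[]]; rewrite subset1 => /orP[]/eqP->; rewrite eqxx.
by rewrite !cards1 cards0 subnn subn0 !expr0 !expr1 mulr1 !mul1r.
Qed.

Lemma expectZ (R : realFieldType) (T : finType) (p : R) (D : {set T}) c f :
  expect p D (fun E => c * f E) = c * expect p D f.
Proof. by rewrite /expect mulr_sumr; apply: eq_bigr => E _; ring. Qed.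

Lemma expectB (R : realFieldType) (T : finType) (p : R) (D : {set T}) f g :
  expect p D (fun E => f E - g E) = expect p D f - expect p D g.
Proof. by rewrite /expect -sumrB; apply: eq_bigr => E _; ring. Qed.

Lemma expectD (R : realFieldType) (T : finType) (p : R) (D : {set T}) f g :
  expect p D (fun E => f E + g E) = expect p D f + expect p D g.
Proof. by rewrite /expect -big_split /=; apply: eq_bigr => E _; ring. Qed.

Lemma expect_sum (R : realFieldType) (T I : finType) (p : R) (D : {set T})
    (P : pred I) (f : I -> {set T} -> R) :
  expect p D (fun E => \sum_(i | P i) f i E) = \sum_(i | P i) expect p D (f i).
Proof.
by rewrite /expect exchange_big /=; apply: eq_bigr => E _; rewrite mulr_sumr.
Qed.

(** The total mass is one; the induction exposes one element at a time. *)
Lemma expect_cst (R : realFieldType) (T : finType) (p : R) (D : {set T}) c :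
  expect p D (fun=> c) = c.
Proof.
have [k] := ubnP #|D|; elim: k D => // k IH D Dk.
have [->|/set0Pn[x xD]] := eqVneq D finset.set0; first exact: expect0.
rewrite (expect_split _ _ (A := [set x])) ?finset.sub1set// expect1 !IH; first by ring.
by move: Dk; rewrite (cardsD1 x D) xD.
Qed.

Lemma expect_setI (R : realFieldType) (T : finType) (p : R) (A D : {set T}) f :
  A \subset D -> expect p D (fun E => f (E :&: A)) = expect p A f.
Proof.
move=> AD; rewrite (expect_split _ _ AD); apply: eq_expect => E1 E1A.
rewrite -[RHS](expect_cst p (D :\: A)); apply: eq_expect => E2.
rewrite subsetD => /andP[_ E2A].
by rewrite finset.setIUl (disjoint_setI0 E2A) finset.setU0 (finset.setIidPl E1A).
Qed.

(** Functions of the traces on disjoint blocks are independent. The index is a list so that the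
    blocks can be exposed one after another. *)
Lemma expect_prod (R : realFieldType) (T I : finType) (p : R) (r : seq I)
    (A : I -> {set T}) (D : {set T}) (g : I -> {set T} -> R) :
  uniq r -> {in r, forall i, A i \subset D} ->
  {in r &, forall i j, i != j -> [disjoint A i & A j]} ->
  expect p D (fun E => \prod_(i <- r) g i (E :&: A i)) =
  \prod_(i <- r) expect p (A i) (g i).
Proof.
elim: r D => [|i r IH] D.
  by move=> _ _ _; rewrite big_nil -[RHS](expect_cst p D); apply: eq_expect => E _;
    rewrite big_nil.
move=> /andP[ir ur] AD dis; rewrite big_cons.
have AiD : A i \subset D by apply: AD; rewrite mem_head.
have ij j : j \in r -> [disjoint A i & A j].
  move=> jr; apply: dis; rewrite ?mem_head ?in_cons ?jr ?orbT//.
  by apply: contraNneq ir => ->.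
rewrite (expect_split _ _ AiD).
rewrite -(IH (D :\: A i)) //; first last.
- by move=> j k jr kr; apply: dis; rewrite in_cons ?jr ?kr orbT.
- by move=> j jr; rewrite subsetD AD ?in_cons ?jr ?orbT// disjoint_sym ij.
rewrite [RHS]mulrC -expectZ; apply: eq_expect => E1 E1A.
rewrite mulrC -expectZ; apply: eq_expect => E2; rewrite subsetD => /andP[_ E2A].
rewrite big_cons finset.setIUl (disjoint_setI0 E2A) finset.setU0 (finset.setIidPl E1A).
congr (_ * _); apply: eq_big_seq => j jr.
rewrite finset.setIUl [E1 :&: A j]disjoint_setI0 ?finset.set0U//.
exact: disjointWl E1A (ij _ jr).
Qed.

Lemma expect_cylinder (R : realFieldType) (T : finType) (p : R) (A B D : {set T}) :
  A \subset D -> B \subset D -> [disjoint A & B] ->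
  expect p D (fun E => ((A \subset E) && [disjoint B & E])%:R) =
  p ^+ #|A| * (1 - p) ^+ #|B|.
Proof.
move=> AD BD AB.
have full : expect p A (fun E => (A \subset E)%:R) = p ^+ #|A|.
  rewrite /expect (bigD1 A)//= subxx subnn expr0 !mulr1 big1 ?addr0//.
  move=> E /andP[EA nEA]; rewrite [A \subset E]negbTE ?mulr0//.
  by apply: contra nEA => AE; rewrite finset.eqEsubset EA.
have empty : expect p B (fun E => [disjoint B & E]%:R) = (1 - p) ^+ #|B|.
  rewrite /expect (bigD1 finset.set0) ?finset.sub0set//= cards0 subn0 expr0 mul1r.
  rewrite -setI_eq0 finset.setI0 eqxx mulr1 big1 ?addr0// => E /andP[EB E0].
  rewrite [[disjoint _ & _]]negbTE ?mulr0//.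
  by apply: contra E0; rewrite -setI_eq0 (finset.setIidPr EB).
have BDA : B \subset D :\: A by rewrite subsetD BD disjoint_sym.
rewrite -full -empty (expect_split _ _ AD) mulrC -expectZ.
apply: eq_expect => E1 E1A; rewrite mulrC -expectZ -(expect_setI _ _ BDA).
apply: eq_expect => E2; rewrite subsetD => /andP[_ E2A].
have -> : (A \subset E1 :|: E2) = (A \subset E1).
  apply/idP/idP => [AE|AE]; last exact: fintype.subset_trans AE (finset.subsetUl _ _).
  apply/fintype.subsetP => x xA; move: (fintype.subsetP AE _ xA).
  by rewrite inE => /orP[//|xE2]; rewrite (disjointFr E2A xE2) in xA.
have -> : [disjoint B & E1 :|: E2] = [disjoint B & E2 :&: B].
  have BE1 : B :&: E1 = finset.set0.
    by apply: disjoint_setI0; rewrite disjoint_sym; apply: disjointWl E1A AB.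
  rewrite -!setI_eq0 finset.setIUr BE1 finset.set0U finset.setICA.
  by rewrite finset.setIid finset.setIC.
by case: (A \subset E1); case: [disjoint _ & _]; rewrite ?mulr0 ?mul0r ?mulr1.
Qed.

(** * Edges from isolated edges to the outer vertices *)

Definition star n (W s : {set 'I_n}) : {set {set 'I_n}} :=
  [set [set x; w] | x in s, w in W].

Lemma star_subset_pairs n (W s : {set 'I_n}) : [disjoint s & W] ->
  star W s \subset pairs n.
Proof.
move=> sW; apply/fintype.subsetP => e /imset2P[x w xs wW ->]; rewrite inE cards2.
by have [xw|//] := eqVneq x w; move: wW; rewrite -xw (disjointFr sW xs).
Qed.

(** This makes the trials at different isolated edges independent. *)
Lemma star_disjoint n (U s t : {set 'I_n}) : s \subset U -> t \subset U ->
  [disjoint s & t] -> [disjoint star (~: U) s & star (~: U) t].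
Proof.
move=> sU tU st; rewrite -setI_eq0; apply/eqP/setP => e; rewrite !inE.
apply/negP => /andP[/imset2P[x w xs wU ->] /imset2P[y v yt vU exy]].
have : x \in [set y; v] by rewrite -exy finset.set21.
move=> /set2P[xy|xv]; first by rewrite xy (disjointFl st yt) in xs.
by move: vU; rewrite -xv inE (fintype.subsetP sU _ xs).
Qed.

Lemma star1_disjoint n (W s : {set 'I_n}) v w : [disjoint s & W] ->
  v \in W -> w \in W -> v != w -> [disjoint star [set v] s & star [set w] s].
Proof.
move=> sW vW wW vw; rewrite -setI_eq0; apply/eqP/setP => e; rewrite !inE.
apply/negP => /andP[/imset2P[x _ xs /set1P-> ->] /imset2P[y _ yt /set1P-> exy]].
have : v \in [set y; w] by rewrite -exy finset.set22.
move=> /set2P[vy|vE]; last by rewrite vE eqxx in vw.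
by move: yt; rewrite -vy (disjointFl sW vW).
Qed.

Lemma cnt_setI n (E A : graph n) (s : {set 'I_n}) w :
  star [set w] s \subset A -> cnt (E :&: A) s w = cnt E s w.
Proof.
move=> sA; apply: eq_card => x; rewrite !inE; case: (boolP (x \in s)) => //= xs.
case: (_ \in E) => //=; apply: (fintype.subsetP sA); apply/imset2P.
by exists x w; rewrite ?set11.
Qed.

Lemma star1_subset n (W s : {set 'I_n}) w : w \in W ->
  star [set w] s \subset star W s.
Proof.
move=> wW; apply/fintype.subsetP => e /imset2P[x _ xs /set1P-> ->].
by apply/imset2P; exists x w.
Qed.

(** The counts at different vertices of [W] are independent and binomial with two trials. Suitable
    choices of [k] yield all the single-edge expectations below. *)
Lemma expect_star (R : realFieldType) n (p : R) (W s : {set 'I_n})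
    (k : 'I_n -> nat -> R) : [disjoint s & W] -> #|s| = 2%N ->
  expect p (star W s) (fun E => \prod_(w in W) k w (cnt E s w)) =
  \prod_(w in W)
    ((1 - p) ^+ 2 * k w 0%N + 2 * p * (1 - p) * k w 1%N + p ^+ 2 * k w 2%N).
Proof.
move=> sW /eqP/cards2P[a [b [ab sE]]].
rewrite -[RHS]big_enum /=.
under eq_expect => E _ do rewrite -big_enum /=.
transitivity (expect p (star W s) (fun E => \prod_(w <- enum W)
    k w (cnt (E :&: star [set w] s) s w))).
  by apply: eq_expect => E _; apply: eq_bigr => w _; rewrite cnt_setI.
rewrite (expect_prod _ (fun w E => k w (cnt E s w))) ?enum_uniq//; first last.
- move=> v w; rewrite !mem_enum => vW wW; exact: star1_disjoint sW vW wW.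
- by move=> w; rewrite mem_enum => /star1_subset.
apply: eq_big_seq => w; rewrite mem_enum => wW.
have aw : a != w.
  by apply: contraTneq wW => <-; rewrite (disjointFr sW)// sE finset.set21.
have bw : b != w.
  by apply: contraTneq wW => <-; rewrite (disjointFr sW)// sE finset.set22.
have awb : [set a; w] != [set b; w].
  by rewrite set2_eqE// (negbTE ab) (negbTE aw).
have st : star [set w] s = [set a; w] |: [set [set b; w]].
  apply/setP => e; rewrite !inE; apply/imset2P/orP => [[x _ xs /set1P-> ->]|].
    by move: xs; rewrite sE => /set2P[->|->]; rewrite eqxx; [left|right].
  by move=> [/eqP->|/eqP->]; [exists a w|exists b w];
    rewrite ?set11 ?sE ?finset.set21 ?finset.set22.
rewrite st (expect_split _ _ (A := [set [set a; w]])); last first.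
  by rewrite finset.sub1set !inE eqxx.
have -> : ([set a; w] |: [set [set b; w]]) :\: [set [set a; w]] = [set [set b; w]].
  apply/setP => e; rewrite !inE; case: eqVneq => //= ->.
  by rewrite (negbTE awb).
rewrite !expect1 sE !cnt_set2// !finset.setU0 !finset.set0U !inE !eqxx.
by rewrite [[set b; w] == [set a; w]]eq_sym !(negbTE awb) /=; ring.
Qed.

(** * Success probability of one trial *)

Lemma natr_forall_in (R : realFieldType) (T : finType) (A : {set T}) (P : pred T) :
  [forall x in A, P x]%:R = \prod_(x in A) (P x)%:R :> R.
Proof.
case: (boolP [forall x in A, P x]) => [/'forall_implyP H|].
  by rewrite big1// => x xA; rewrite H.
rewrite negb_forall => /existsP[x]; rewrite negb_imply => /andP[xA Px].
by rewrite (bigD1 x)//= (negbTE Px) mul0r.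
Qed.

Lemma prodr_const_if (R : realFieldType) (T : finType) (W Z : {set T}) (x y : R) :
  Z \subset W ->
  \prod_(w in W) (if w \in Z then x else y) = x ^+ #|Z| * y ^+ (#|W| - #|Z|).
Proof.
move=> ZW; rewrite (bigID (mem Z)) /=; congr (_ * _).
  rewrite -prodr_const; apply: eq_big => [w|w /andP[_ ->]//].
  by case: (boolP (w \in Z)) => [/(fintype.subsetP ZW)->|]; rewrite ?andbF.
have -> : (#|W| - #|Z| = #|W :\: Z|)%N by rewrite cardsD (finset.setIidPr ZW).
rewrite -prodr_const; apply: eq_big => [w|w /andP[_ /negbTE->]//].
by rewrite !inE andbC.
Qed.

(* Writing the parity as a sign turns the event into a combination of products
   over the independent vertices of [W]. *)
Lemma natr_light_odd_avoiding (R : realFieldType) n (W Z s : {set 'I_n}) (E : graph n) :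
  (light_odd_avoiding W Z s E)%:R =
  2^-1 * (\prod_(w in W) (cnt E s w <= (w \notin Z))%N%:R -
     \prod_(w in W) ((cnt E s w <= (w \notin Z))%N%:R * (-1) ^+ cnt E s w)) :> R.
Proof.
rewrite big_split /= prodrXr -natr_forall_in -/(light_avoiding W Z s E).
rewrite /light_odd_avoiding -signr_odd.
by case: light_avoiding; case: odd; rewrite /= ?expr0 ?expr1; lra.
Qed.

Lemma expect_light_odd_avoiding (R : realFieldType) n (p : R) (W Z s : {set 'I_n}) :
  [disjoint s & W] -> #|s| = 2%N -> Z \subset W ->
  expect p (star W s) (fun E => (light_odd_avoiding W Z s E)%:R) =
  2^-1 * ((1 - p) ^+ 2) ^+ #|Z| *
   ((1 - p ^+ 2) ^+ (#|W| - #|Z|) - ((1 - p) * (1 - 3 * p)) ^+ (#|W| - #|Z|)).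
Proof.
move=> sW s2 ZW.
under eq_expect => E _ do rewrite natr_light_odd_avoiding.
rewrite expectZ expectB.
rewrite (expect_star _ (fun w c => (c <= (w \notin Z))%N%:R))//.
rewrite (expect_star _ (fun w c => (c <= (w \notin Z))%N%:R * (-1) ^+ c))//.
(* A vertex of [Z] must see neither end; any other vertex sees at most one, with probability
   [1 - p ^+ 2]. *)
have -> : \prod_(w in W) ((1 - p) ^+ 2 * (0 <= (w \notin Z))%N%:R +
    2 * p * (1 - p) * (1 <= (w \notin Z))%N%:R + p ^+ 2 * (2 <= (w \notin Z))%N%:R)
    = ((1 - p) ^+ 2) ^+ #|Z| * (1 - p ^+ 2) ^+ (#|W| - #|Z|).
  by rewrite -prodr_const_if//; apply: eq_bigr => w _; case: (w \in Z) => /=; ring.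
(* With the sign, a vertex outside [Z] contributes [(1 - p) ^+ 2 - 2 * p * (1 - p)], which is
   [(1 - p) * (1 - 3 * p)]. *)
have -> : \prod_(w in W) ((1 - p) ^+ 2 * ((0 <= (w \notin Z))%N%:R * (-1) ^+ 0) +
    2 * p * (1 - p) * ((1 <= (w \notin Z))%N%:R * (-1) ^+ 1) +
    p ^+ 2 * ((2 <= (w \notin Z))%N%:R * (-1) ^+ 2))
    = ((1 - p) ^+ 2) ^+ #|Z| * ((1 - p) * (1 - 3 * p)) ^+ (#|W| - #|Z|).
  by rewrite -prodr_const_if//; apply: eq_bigr => w _; case: (w \in Z) => /=; ring.
by ring.
Qed.

(** Input for Markov's inequality. By linearity one vertex [v] at a time is required to see exactly
    one end, which leaves the factor [1 - p ^+ 2] for each other vertex. *)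
Lemma expect_light_cnt (R : realFieldType) n (p : R) (W s : {set 'I_n}) :
  [disjoint s & W] -> #|s| = 2%N ->
  expect p (star W s) (fun E => (light_avoiding W finset.set0 s E)%:R *
     (\sum_(w in W) cnt E s w)%N%:R) =
  #|W|%:R * (2 * p * (1 - p)) * (1 - p ^+ 2) ^+ #|W|.-1.
Proof.
move=> sW s2.
transitivity (expect p (star W s) (fun E => \sum_(v in W) \prod_(w in W)
    ((cnt E s w <= 1)%N%:R * (if w == v then (cnt E s w)%:R else 1)))).
  apply: eq_expect => E _; rewrite natr_sum mulr_sumr; apply: eq_bigr => v vW.
  rewrite big_split /= natr_forall_in; congr (_ * _).
    by apply: eq_bigr => w _; rewrite inE.
  rewrite (bigD1 v)//= eqxx big1 ?mulr1// => w /andP[_ wv].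
  by rewrite (negbTE wv).
rewrite expect_sum.
under eq_bigr => v vW.
  rewrite (expect_star _ (fun w c => (c <= 1)%N%:R * (if w == v then c%:R else 1)))//.
  rewrite (bigD1 v)//= eqxx (eq_bigr (fun=> 1 - p ^+ 2)); last first.
    by move=> w /andP[_ wv]; rewrite (negbTE wv); ring.
  rewrite (eq_bigl (mem (W :\ v))); last by move=> w; rewrite !inE andbC.
  rewrite prodr_const.
  have -> : #|W :\ v| = #|W|.-1 by rewrite (cardsD1 v W) vW.
  rewrite !(mulr0, mul0r, mulr1, addr0, add0r, mul1r).
  over.
rewrite sumr_const -mulr_natl. ring.
Qed.

(** A rational substitute for the bound by [exp (- N x)]. It serves both for the parity gap and for
    the failure of many trials. *)
Lemma expr1B_le_inv (R : realFieldType) (x : R) N : 0 <= x <= 1 ->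
  (1 - x) ^+ N <= (1 + N%:R * x)^-1.
Proof.
move=> /andP[x0 x1].
have pos k : 0 < 1 + k%:R * x by rewrite ltr_wpDr// mulr_ge0.
rewrite -[_^-1]mul1r ler_pdivlMr//.
elim: N => [|N IH]; first by rewrite expr0 mul0r addr0 mul1r.
apply: le_trans IH; rewrite exprSr -mulrA; apply: ler_wpM2l.
  by rewrite exprn_ge0// subr_ge0.
rewrite -natr1; have := sqr_ge0 x; have : 0 <= N%:R :> R by [].
by move: (N%:R : R) => k; nra.
Qed.

(** The base [(1 - p) * (1 - 3 * p)] equals [1 - p ^+ 2] times [1 - 4 * p / (1 + p)], so
    [expr1B_le_inv] applies to the second factor. The bound [p <= 1 / 3] keeps [4 * p / (1 + p)] at
    most one. *)
Lemma parity_gap_ge (R : realFieldType) (p : R) K : 0 <= p <= 3^-1 ->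
  let y := K%:R * p / (1 + p) in
  (1 - p ^+ 2) ^+ K * (4 * y / (1 + 4 * y)) <=
  (1 - p ^+ 2) ^+ K - ((1 - p) * (1 - 3 * p)) ^+ K.
Proof.
move=> /andP[p0 p3] /=; set y := K%:R * p / (1 + p).
have p1 : 0 < 1 + p by lra.
have y0 : 0 <= y by rewrite /y divr_ge0 ?mulr_ge0// ltW.
have -> : (1 - p) * (1 - 3 * p) = (1 - p ^+ 2) * (1 - 4 * p / (1 + p)).
  by field; rewrite gt_eqF.
rewrite exprMn -{2}[(1 - p ^+ 2) ^+ K]mulr1 -mulrBr; apply: ler_wpM2l.
  by rewrite exprn_ge0// subr_ge0; nra.
have -> : 4 * y / (1 + 4 * y) = 1 - (1 + K%:R * (4 * p / (1 + p)))^-1.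
  rewrite /y; field.
  by rewrite ?gt_eqF//=; apply: ltr_pwDl => //; rewrite ?mulr_ge0// ltW.
rewrite lerD2l lerN2; apply: expr1B_le_inv.
rewrite divr_ge0 ?mulr_ge0 ?(ltW p1)//=.
by rewrite ler_pdivrMr//; lra.
Qed.

(* The first factors are the probabilities of avoiding [t] given vertices and of
   having no common neighbour among [N] vertices; the last one comes from
   [parity_gap_ge]. *)
Definition success_bound (R : realFieldType) (p : R) (N t : nat) : R :=
  let y := N%:R * p / (1 + p) in
  2 / 5 * ((1 - p) ^+ 2) ^+ t * (1 - p ^+ 2) ^+ N * (y / (1 + 4 * y)).

(** At least half of [W] lies outside [Z], so the parity gap is at worst a constant factor below the
    one for all of [W]. The bound is shared with the edge found first, whose Markov step dictates
    the constant [2 / 5]. *)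
Lemma light_odd_avoiding_prob_ge (R : realFieldType) n (p : R)
    (W Z s : {set 'I_n}) (t : nat) :
  [disjoint s & W] -> #|s| = 2%N -> Z \subset W -> 0 <= p <= 3^-1 ->
  (#|Z| <= t)%N -> (2 * t <= #|W|)%N ->
  success_bound p #|W| t <=
  expect p (star W s) (fun E => (light_odd_avoiding W Z s E)%:R).
Proof.
move=> sW s2 ZW p03 Zt tW; rewrite expect_light_odd_avoiding//.
have /andP[p0 p3] := p03.
set z := #|Z|; set N := #|W|.
have p1 : 0 < 1 + p by lra.
have q0 : 0 <= (1 - p) ^+ 2 <= 1 by rewrite sqr_ge0 /=; nra.
have r0 : 0 <= 1 - p ^+ 2 <= 1 by nra.
apply: le_trans (_ : 2^-1 * ((1 - p) ^+ 2) ^+ z * _ <= _); last first.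
  apply: ler_wpM2l; first by rewrite mulr_ge0// exprn_ge0//; case/andP: q0.
  exact: parity_gap_ge.
rewrite /=; set y := (N - z)%:R * p / (1 + p).
set x := N%:R * p / (1 + p).
have x0 : 0 <= x by rewrite /x divr_ge0 ?mulr_ge0// ltW.
have yx : x <= 2 * y.
  rewrite /x /y mulrA ler_pM2r ?invr_gt0// mulrA ler_wpM2r//.
  by rewrite -natrM ler_nat /z /N; move: Zt tW; clear; lia.
have y0 : 0 <= y by lra.
rewrite /success_bound -/x.
have -> : 2^-1 * ((1 - p) ^+ 2) ^+ z *
    ((1 - p ^+ 2) ^+ (N - z) * (4 * y / (1 + 4 * y))) =
    ((1 - p) ^+ 2) ^+ z * (1 - p ^+ 2) ^+ (N - z) * (2 * y / (1 + 4 * y)).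
  by field; rewrite gt_eqF//; lra.
have -> : 2 / 5 * ((1 - p) ^+ 2) ^+ t * (1 - p ^+ 2) ^+ #|W| * (x / (1 + 4 * x)) =
  ((1 - p) ^+ 2) ^+ t * (1 - p ^+ 2) ^+ N * (2 / 5 * (x / (1 + 4 * x))).
  by field; rewrite gt_eqF//; lra.
case/andP: q0 => q0 q1; case/andP: r0 => r0 r1.
apply: ler_pM; rewrite ?mulr_ge0 ?exprn_ge0 ?invr_ge0//; try lra.
  apply: ler_pM; rewrite ?exprn_ge0//; [by lra|exact: ler_wiXn2l|].
  by apply: ler_wiXn2l => //; exact: leq_subr.
rewrite mulrA ler_pdivrMr; last by lra.
rewrite [leRHS]mulrAC ler_pdivlMr; last by lra.
by nra.
Qed.

(* Markov's inequality on the event without common neighbours: it costs a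
   fraction [4 / 5] of the probability, because [t >= (5 / 4) (1 + 4 y)]. *)
Lemma light_odd_bounded_prob_ge (R : realFieldType) n (p : R)
    (W s : {set 'I_n}) (t : nat) :
  [disjoint s & W] -> #|s| = 2%N -> 0 <= p <= 3^-1 ->
  5 * #|W|%:R * p + 2 <= t%:R ->
  success_bound p #|W| t <=
  expect p (star W s) (fun E =>
    (light_odd_avoiding W finset.set0 s E && (\sum_(w in W) cnt E s w <= t)%N)%:R).
Proof.
move=> sW s2 p03 tN; have /andP[p0 p3] := p03.
have t0 : 0 < t%:R :> R.
  by apply: lt_le_trans tN; rewrite ltr_wpDl// ?mulr_ge0.
apply: le_trans (_ : expect p (star W s) (fun E =>
    (light_odd_avoiding W finset.set0 s E)%:R - t%:R^-1 *
    ((light_avoiding W finset.set0 s E)%:R * (\sum_(w in W) cnt E s w)%N%:R)) <= _);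
  last first.
  apply: le_expect => [|E _]; first by rewrite p0 /=; lra.
  set S := (\sum_(w in W) _)%N; rewrite /light_odd_avoiding -/S.
  case: light_avoiding; rewrite /= ?mul0r ?mulr0 ?subr0// mul1r.
  have S0 : 0 <= t%:R^-1 * S%:R :> R by rewrite mulr_ge0// invr_ge0.
  case: (odd S); rewrite /= ?sub0r ?oppr_le0//.
  case: leqP => [_|tS] /=; first by lra.
  rewrite subr_le0 mulrC ler_pdivlMr// mul1r ler_nat; exact: ltnW.
rewrite expectB expectZ expect_light_cnt// expect_light_odd_avoiding// ?finset.sub0set//.
rewrite cards0 subn0 expr0 mulr1.
set N := #|W|; set x := N%:R * p / (1 + p).
have p1 : 0 < 1 + p by lra.
have x0 : 0 <= x by rewrite /x divr_ge0 ?mulr_ge0// ltW.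
have q0 : 0 <= (1 - p) ^+ 2 <= 1 by rewrite sqr_ge0 /=; nra.
have r0 : 0 <= 1 - p ^+ 2 <= 1 by nra.
(* The predecessor truncates at [N = 0], where both sides vanish. *)
have -> : N%:R * (2 * p * (1 - p)) * (1 - p ^+ 2) ^+ N.-1 =
    (1 - p ^+ 2) ^+ N * (2 * x).
  rewrite /x; move: (N) => [|k]; first by rewrite !mul0r !mulr0.
  have E (u v : R) : u * (2 * p * (1 - p)) * v =
      (1 - p ^+ 2) * v * (2 * (u * p / (1 + p))) by field; rewrite gt_eqF.
  by rewrite /= [_ ^+ k.+1]exprS E.
have xt : 5 * x + 2 <= t%:R.
  apply: le_trans tN; rewrite lerD2r -mulrA ler_wpM2l// /x.
  by rewrite ler_pdivrMr// ler_peMr ?mulr_ge0//; lra.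
have := parity_gap_ge N p03; rewrite /= -/x => gap.
apply: le_trans (_ : (1 - p ^+ 2) ^+ N * (2 * x / (1 + 4 * x) - 2 * x / t%:R) <= _);
  last first.
  have -> : (1 - p ^+ 2) ^+ N * (2 * x / (1 + 4 * x) - 2 * x / t%:R) =
    2^-1 * ((1 - p ^+ 2) ^+ N * (4 * x / (1 + 4 * x))) -
    t%:R^-1 * ((1 - p ^+ 2) ^+ N * (2 * x)).
    by field; rewrite !gt_eqF//; lra.
  by rewrite lerD2r ler_wpM2l.
rewrite /success_bound -/x.
case/andP: q0 => q0 q1; case/andP: r0 => r0 r1.
apply: le_trans (_ : (1 - p ^+ 2) ^+ N * (2 / 5 * (x / (1 + 4 * x))) <= _).
  have -> : 2 / 5 * ((1 - p) ^+ 2) ^+ t * (1 - p ^+ 2) ^+ #|W| * (x / (1 + 4 * x)) =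
    ((1 - p) ^+ 2) ^+ t * ((1 - p ^+ 2) ^+ N * (2 / 5 * (x / (1 + 4 * x)))).
    by field; rewrite gt_eqF//; lra.
  apply: ler_piMl; last exact: exprn_ile1.
  by rewrite mulr_ge0 ?exprn_ge0// mulr_ge0// divr_ge0//; lra.
apply: ler_wpM2l; first exact: exprn_ge0.
have : 2 * x / t%:R <= 8 / 5 * (x / (1 + 4 * x)).
  have xu : x = x / (1 + 4 * x) * (1 + 4 * x) by rewrite divfK// gt_eqF//; lra.
  have u0 : 0 <= x / (1 + 4 * x) by rewrite divr_ge0//; lra.
  rewrite ler_pdivrMr//; move: u0 xu xt x0; move: (x / (1 + 4 * x)) => u.
  by clearbody x; move: t%:R => T; nra.
have -> : 2 * x / (1 + 4 * x) = 2 * (x / (1 + 4 * x)) by rewrite mulrA.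
by move: (2 * x / t%:R) (x / (1 + 4 * x)) => u v; lra.
Qed.

(** * Exposing the inner pairs before the outer ones *)

Definition inner_pairs n (U : {set 'I_n}) : {set {set 'I_n}} :=
  [set e in pairs n | e \subset U].

(** Once the inner pairs are exposed, the isolated edges are fixed while all pairs leaving [U] are
    still random. *)
Lemma isolated_edges_setU n (U : {set 'I_n}) (E1 E2 : graph n) :
  E1 \subset inner_pairs U -> E2 \subset pairs n :\: inner_pairs U ->
  isolated_edges U (E1 :|: E2) = isolated_edges U E1.
Proof.
move=> /fintype.subsetP E1U /fintype.subsetP E2U.
have E2n e : e \in E2 -> e \subset U = false.
  by move=> /E2U; rewrite !inE => /andP[+ ep]; rewrite ep => /negbTE.
apply/setP => s; rewrite !inE.
have [sU|sU] := boolP (s \subset U); last by rewrite !andbF.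
have -> : (s \in E2) = false by apply: contraTF sU => /E2n->.
rewrite orbF; congr (_ && _).
apply: eq_forallb => e; rewrite !inE.
by case: (boolP (e \in E2)) => [/E2n->|_]; rewrite ?orbF ?orbT// !implybT.
Qed.

Lemma star_subset_outer n (U s : {set 'I_n}) : s \subset U ->
  star (~: U) s \subset pairs n :\: inner_pairs U.
Proof.
move=> sU; have sW : [disjoint s & ~: U].
  by rewrite -setI_eq0 -finset.setDE finset.setD_eq0.
rewrite subsetD star_subset_pairs//= -setI_eq0; apply/eqP/setP => e; rewrite !inE.
apply/negP => /andP[/imset2P[x w _ wU ->] /andP[_ /fintype.subsetP/(_ w)]].
by rewrite finset.set22 => /(_ isT) wU'; rewrite inE wU' in wU.
Qed.

Lemma cnt_setU n (E F A : graph n) (s : {set 'I_n}) w :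
  star [set w] s \subset A -> [disjoint F & A] -> cnt (E :|: F) s w = cnt E s w.
Proof.
move=> sA FA; rewrite -(cnt_setI _ sA) -[RHS](cnt_setI _ sA).
by rewrite finset.setIUl (disjoint_setI0 FA) finset.setU0.
Qed.

Lemma eq_light_odd_avoiding n (W Z s : {set 'I_n}) (E F : graph n) :
  {in W, forall w, cnt E s w = cnt F s w} ->
  light_odd_avoiding W Z s E = light_odd_avoiding W Z s F.
Proof.
move=> EF; rewrite /light_odd_avoiding (eq_bigr _ EF); congr (_ && _).
apply: eq_forallb => w; case: (boolP (w \in W)) => //= wW.
by rewrite EF.
Qed.

Lemma isolated_edges_card n (U : {set 'I_n}) (E : graph n) s :
  is_graph E -> s \in isolated_edges U E -> #|s| = 2%N.
Proof.
move=> /fintype.subsetP gE; rewrite inE => /and3P[/gE + _ _].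
by rewrite inE => /eqP.
Qed.

Lemma isolated_edges_sub n (U : {set 'I_n}) (E : graph n) s :
  s \in isolated_edges U E -> s \subset U.
Proof. by rewrite inE => /and3P[]. Qed.

Lemma isolated_edges_disjoint n (U : {set 'I_n}) (E : graph n) s t :
  s \in isolated_edges U E -> t \in isolated_edges U E -> s != t ->
  [disjoint s & t].
Proof.
rewrite inE => /and3P[_ _ /'forall_implyP H] /[!inE] /and3P[tE tU _] st.
by have := H _ tE; rewrite tU eq_sym st.
Qed.

(** The product is the indicator that every trial in [I] fails, and the trials live on disjoint
    stars. *)
Lemma expect_prod_compl_le (R : realFieldType) n (p r : R) (U : {set 'I_n})
    (E1 : graph n) (I : {set {set 'I_n}}) (D : {set {set 'I_n}})
    (a : {set 'I_n} -> graph n -> bool) :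
  0 <= r <= 1 -> 0 <= p <= 1 ->
  I \subset isolated_edges U E1 ->
  {in I, forall s, star (~: U) s \subset D} ->
  {in I, forall s, r <= expect p (star (~: U) s) (fun E => (a s E)%:R)} ->
  expect p D (fun E => \prod_(s in I) (1 - (a s (E :&: star (~: U) s))%:R)) <=
  (1 - r) ^+ #|I|.
Proof.
move=> r01 p01 /fintype.subsetP IE ID ra.
have -> : expect p D (fun E => \prod_(s in I) (1 - (a s (E :&: star (~: U) s))%:R)) =
    \prod_(s in I) expect p (star (~: U) s) (fun E => 1 - (a s E)%:R).
  rewrite -[RHS]big_enum /=.
  under eq_expect => E _ do rewrite -big_enum /=.
  rewrite (expect_prod _ (fun s E => 1 - (a s E)%:R)) ?enum_uniq//.
  - by move=> s; rewrite mem_enum => /ID.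
  - move=> s t; rewrite !mem_enum => /IE sI /IE tI st.
    by apply: star_disjoint; rewrite ?(isolated_edges_sub sI) ?(isolated_edges_sub tI)//;
      apply: isolated_edges_disjoint sI tI st.
rewrite -prodr_const; apply: ler_prod => s sI; apply/andP; split.
  rewrite -(expect_cst p (star (~: U) s) 0); apply: le_expect => // E _.
  by case: (a s E); rewrite ?subrr ?subr0.
by rewrite expectB expect_cst lerD2l lerN2 ra.
Qed.

(** A search in two stages. The stars of [I] are exposed first; finding no good [s] there costs the
    first summand. Otherwise the stars of [J] are still random, and finding no partner that avoids
    the neighbours of [s] costs the second. *)
Lemma outer_reconstructible_le (R : realFieldType) n (p : R) (U : {set 'I_n})
    (E1 : graph n) (I J : {set {set 'I_n}}) (t : nat) :
  let N := #|~: U| in let r := success_bound p N t in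
  0 <= p <= 3^-1 -> 0 <= r <= 1 -> 5 * N%:R * p + 2 <= t%:R -> (2 * t <= N)%N ->
  E1 \subset inner_pairs U -> I \subset isolated_edges U E1 ->
  J \subset isolated_edges U E1 -> [disjoint I & J] ->
  expect p (pairs n :\: inner_pairs U)
    (fun E2 => `[< reconstructible 1 (E1 :|: E2) >]%:R) <=
  (1 - r) ^+ #|I| + (1 - r) ^+ #|J|.
Proof.
move=> N r p03 r01 tN tN2 E1U IE JE IJ.
have p01 : 0 <= p <= 1 by case/andP: p03 => p0 p3; rewrite p0 /=; lra.
set W := ~: U; set D := pairs n :\: inner_pairs U.
have E1n : E1 \subset pairs n.
  by apply: fintype.subset_trans E1U _; apply/fintype.subsetP => e; rewrite inE => /andP[].
have isoU s : s \in isolated_edges U E1 -> [/\ #|s| = 2%N, s \subset U & [disjoint s & W]].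
  move=> sI; have sU := isolated_edges_sub sI.
  by split; rewrite ?(isolated_edges_card E1n sI)// -setI_eq0 -finset.setDE finset.setD_eq0.
set A := \bigcup_(s in I) star W s.
have AD : A \subset D.
  by apply/bigcupsP => s /(fintype.subsetP IE)/isoU[_ sU _]; exact: star_subset_outer.
have JA s : s \in J -> [disjoint star W s & A].
  move=> sJ; apply/bigcup_disjointP => s' s'I.
  have sE := fintype.subsetP JE _ sJ; have s'E := fintype.subsetP IE _ s'I.
  apply: star_disjoint; rewrite ?(isolated_edges_sub sE) ?(isolated_edges_sub s'E)//.
  apply: isolated_edges_disjoint sE s'E _.
  by apply: contraTneq s'I => <-; rewrite (disjointFl IJ sJ).
have E1star s : s \in isolated_edges U E1 -> [disjoint E1 & star W s].
  move=> /isoU[_ sU _]; apply: disjointWl E1U _; rewrite disjoint_sym.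
  by have := star_subset_outer sU; rewrite subsetD => /andP[].
pose aI s E := light_odd_avoiding W finset.set0 s E && (\sum_(w in W) cnt E s w <= t)%N.
rewrite (expect_split _ _ AD).
apply: (@le_trans _ _ (expect p A (fun E => \prod_(s in I) (1 - (aI s (E :&: star W s))%:R)
    + (1 - r) ^+ #|J|))); last first.
  rewrite expectD expect_cst lerD2r.
  apply: (expect_prod_compl_le (E1 := E1)) => //.
    by move=> s sI; apply: finset.bigcup_sup.
  move=> s /(fintype.subsetP IE)/isoU[s2 sU sW].
  exact: light_odd_bounded_prob_ge.
apply: le_expect => // Ea EaA.
have [/existsP[s /andP[sI sa]]|] := boolP [exists s in I, aI s (Ea :&: star W s)]; last first.
  rewrite negb_exists => /forallP none.
  rewrite [X in _ <= X + _]big1; last first.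
    by move=> s sI; have := none s; rewrite sI /= => /negbTE->; rewrite subr0.
  apply: le_trans (_ : 1 <= _); last by rewrite lerDl exprn_ge0// subr_ge0; case/andP: r01.
  rewrite -[leRHS](expect_cst p (D :\: A)); apply: le_expect => // Eb _.
  by case: asbool.
have sE := fintype.subsetP IE _ sI; have [s2 sU sW] := isoU _ sE.
have cntI E w : w \in W -> cnt (E :&: star W s) s w = cnt E s w.
  by move=> wW; rewrite cnt_setI// star1_subset.
have sa' : aI s Ea.
  move: sa; rewrite /aI (eq_bigr _ (cntI Ea)).
  by rewrite (eq_light_odd_avoiding _ (cntI Ea)).
(* [Z] is determined by [Ea], so it stays fixed while the stars of [J] are exposed. Each of its
   vertices adds at least one to the count bounded by [t]. *)
set Z := [set w in W | 0 < cnt Ea s w]%N.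
have ZW : Z \subset W by apply/fintype.subsetP => w; rewrite inE => /andP[].
have Zt : (#|Z| <= t)%N.
  case/andP: sa' => _; apply: leq_trans; rewrite -sum1dep_card big_mkcondr /=.
  by apply: leq_sum => w _; case: (cnt _ _ _).
apply: le_trans (_ : (1 - r) ^+ #|J| <= _); last first.
  rewrite lerDr prodr_ge0// => u _; by case: (aI _ _); rewrite ?subrr ?subr0.
have JD u : u \in J -> star W u \subset D :\: A.
  move=> uJ; rewrite subsetD JA// andbT; apply: star_subset_outer.
  exact: isolated_edges_sub (fintype.subsetP JE _ uJ).
apply: le_trans (expect_prod_compl_le (E1 := E1) (a := light_odd_avoiding W Z)
  r01 p01 JE JD _); last first.
  move=> u /(fintype.subsetP JE)/isoU[u2 uU uW].
  exact: light_odd_avoiding_prob_ge.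
apply: le_expect => // Eb EbD.
case: (asboolP (reconstructible _ _)) => [rec|_]; last first.
  by rewrite prodr_ge0// => u _; case: light_odd_avoiding; rewrite ?subrr ?subr0.
(* On a reconstructible graph every trial in [J] must fail, so the product is one. *)
rewrite big1// => u uJ.
have uE := fintype.subsetP JE _ uJ.
case: (boolP (light_odd_avoiding _ _ _ _)) => [ua|]; last by rewrite subr0.
exfalso; move: rec.
have EabD : Ea :|: Eb \subset D.
  rewrite finset.subUset (fintype.subset_trans EaA AD).
  by apply: fintype.subset_trans EbD _; exact: finset.subsetDl.
have disU (F1 F2 B : graph n) : [disjoint F1 & B] -> [disjoint F2 & B] ->
    [disjoint F1 :|: F2 & B].
  by move=> F1B F2B; rewrite -setI_eq0 finset.setIUl !disjoint_setI0// finset.setU0.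
(* Pairs outside the star of [s] do not affect its counts, so what was found on the exposed block
   persists in the whole graph; likewise for [u] below. *)
have cntE w : w \in W -> cnt (E1 :|: (Ea :|: Eb)) s w = cnt Ea s w.
  move=> wW; rewrite finset.setUCA (cnt_setU _ (star1_subset _ wW))//.
  apply: disU; first exact: E1star.
  move: EbD; rewrite subsetD => /andP[_]; apply: disjointWr.
  exact: finset.bigcup_sup.
have cntF w : w \in W -> cnt (E1 :|: (Ea :|: Eb)) u w = cnt (Eb :&: star W u) u w.
  move=> wW; rewrite cnt_setI ?star1_subset// finset.setUA finset.setUC.
  rewrite (cnt_setU _ (star1_subset _ wW))//; apply: disU; first exact: E1star.
  by rewrite disjoint_sym; apply: disjointWr EaA (JA _ uJ).
have isoE : isolated_edges U (E1 :|: (Ea :|: Eb)) = isolated_edges U E1.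
  exact: isolated_edges_setU.
apply: (@light_odd_not_reconstructible _ U s u); rewrite ?isoE//.
- rewrite /is_graph finset.subUset E1n (fintype.subset_trans EabD)//.
  exact: finset.subsetDl.
- by apply: contraTneq sI => ->; rewrite (disjointFl IJ uJ).
- by rewrite (eq_light_odd_avoiding _ cntE); case/andP: sa'.
- rewrite (eq_light_odd_avoiding _ cntF).
  rewrite (_ : [set w in _ | _] = Z)//; apply/setP => w; rewrite !inE.
  case: (boolP (w \in U)) => //= wU; rewrite cntE// inE.
  exact: wU.
Qed.

(** * The number of isolated edges *)

Lemma card_star_le n (W s : {set 'I_n}) : (#|star W s| <= #|s| * #|W|)%N.
Proof.
by rewrite /star curry_imset2X -cardsX; exact: leq_imset_card.
Qed.

Definition touching n (U s : {set 'I_n}) : {set {set 'I_n}} :=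
  [set e in inner_pairs U | (e != s) && ~~ [disjoint s & e]].

Lemma pairs_setE n (e : {set 'I_n}) x y : e \in pairs n -> x \in e -> y \in e ->
  x != y -> e = [set x; y].
Proof.
rewrite inE => /cards2P[a [b [ab ->]]] /set2P[->|->] /set2P[->|->]; rewrite ?eqxx//.
by rewrite finset.setUC.
Qed.

Lemma card_touching_le n (U s : {set 'I_n}) : #|s| = 2%N ->
  (#|touching U s| <= 2 * #|U|)%N.
Proof.
move=> s2; rewrite -s2; apply: leq_trans (card_star_le U s).
apply/subset_leq_card/fintype.subsetP => e; rewrite !inE => /and3P[/andP[e2 eU] _].
rewrite -setI_eq0 => /set0Pn[x]; rewrite inE => /andP[xs xe].
have /cards2P[a [b [ab eE]]] := e2.
have aU : a \in U by apply: (fintype.subsetP eU); rewrite eE finset.set21.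
have bU : b \in U by apply: (fintype.subsetP eU); rewrite eE finset.set22.
apply/imset2P; move: xe; rewrite eE => /set2P[xa|xb].
  by exists x b; rewrite -?xa.
by exists x a; rewrite -?xb// finset.setUC.
Qed.

(** A pair meeting two disjoint pairs joins an end of one to an end of the other. This is the source
    of the exponent 4 in the correlation bound. *)
Lemma card_touchingI_le n (U s t : {set 'I_n}) : #|s| = 2%N -> #|t| = 2%N ->
  [disjoint s & t] -> (#|touching U s :&: touching U t| <= 4)%N.
Proof.
move=> s2 t2 st; have := card_star_le t s; rewrite s2 t2; apply: leq_trans.
apply/subset_leq_card/fintype.subsetP => e; rewrite !inE.
rewrite -!setI_eq0 => /andP[/and3P[/andP[e2 _] _ /set0Pn[x]]].
rewrite inE => /andP[xs xe] /and3P[_ _ /set0Pn[y]]; rewrite inE => /andP[yt ye].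
apply/imset2P; exists x y => //; apply: pairs_setE => //; first by rewrite inE.
by apply: contraTneq yt => <-; rewrite (disjointFr st xs).
Qed.

(** Isolation as a cylinder event: one pair present and a set of pairs absent. *)
Lemma mem_isolated_edges n (U s : {set 'I_n}) (E : graph n) :
  s \in inner_pairs U -> E \subset inner_pairs U ->
  (s \in isolated_edges U E) = ([set s] \subset E) && [disjoint touching U s & E].
Proof.
rewrite !inE => /andP[s2 sU] /fintype.subsetP EU; rewrite sU finset.sub1set /=.
congr (_ && _); apply/'forall_implyP/idP => [H|dis e eE].
  rewrite -setI_eq0; apply/eqP/setP => e; rewrite [RHS]inE; apply/negbTE/negP.
  rewrite finset.in_setI => /andP[+ eE]; rewrite !inE => /and3P[/andP[_ eU] es].
  by have := H _ eE; rewrite eU es /= => ->.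
apply/implyP => eU; apply/implyP => es; apply: contraT => ndis.
have et : e \in touching U s by rewrite inE EU// es ndis.
by rewrite (disjointFr dis et) in eE.
Qed.

Lemma touching_disjoint_edge n (U s : {set 'I_n}) : [disjoint [set s] & touching U s].
Proof. by rewrite disjoints1 !inE eqxx !andbF. Qed.

Lemma isolated_prob (R : realFieldType) n (p : R) (U s : {set 'I_n}) :
  s \in inner_pairs U ->
  expect p (inner_pairs U) (fun E => (s \in isolated_edges U E)%:R) =
  p * (1 - p) ^+ #|touching U s|.
Proof.
move=> sU; under eq_expect => E EU do rewrite mem_isolated_edges//.
rewrite expect_cylinder ?cards1 ?expr1 ?finset.sub1set ?touching_disjoint_edge//.
by apply/fintype.subsetP => e; rewrite inE => /andP[].
Qed.

(** Two distinct edges that meet are never both isolated. For disjoint ones at most four absent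
    pairs are counted twice in the product of the probabilities. *)
Lemma isolated2_prob_le (R : realFieldType) n (p : R) (U s t : {set 'I_n}) :
  0 <= p < 1 -> s \in inner_pairs U -> t \in inner_pairs U -> s != t ->
  expect p (inner_pairs U)
    (fun E => ((s \in isolated_edges U E) && (t \in isolated_edges U E))%:R) <=
  (p * (1 - p) ^+ #|touching U s|) * (p * (1 - p) ^+ #|touching U t|) *
    (1 - p) ^- 4.
Proof.
move=> /andP[p0 p1] sU tU st; have q0 : 0 < 1 - p by rewrite subr_gt0.
have card2 u : u \in inner_pairs U -> #|u| = 2%N by rewrite !inE => /andP[/eqP].
have [dis|ndis] := boolP [disjoint s & t]; last first.
  apply: (@le_trans _ _ 0).
    rewrite -[leRHS](expect_cst p (inner_pairs U)); apply: le_expect.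
      by rewrite p0 ltW.
    move=> E EU; case: (boolP (s \in _)) => //= sI; case: (boolP (t \in _)) => //= tI.
    by move: ndis; rewrite (isolated_edges_disjoint sI tI st).
  by rewrite mulr_ge0// ?invr_ge0 ?exprn_ge0 ?mulr_ge0 ?exprn_ge0// ltW.
have tS u : touching U u \subset inner_pairs U.
  by apply/fintype.subsetP => e; rewrite inE => /andP[].
rewrite (eq_expect p (g := fun E => (([set s; t] \subset E) &&
    [disjoint touching U s :|: touching U t & E])%:R)); last first.
  move=> E EU; rewrite !mem_isolated_edges// finset.subUset -!setI_eq0.
  rewrite finset.setIUl finset.setU_eq0 -!andbA; congr (_ && _)%:R.
  by rewrite andbCA.
have st2 : [set s; t] \subset inner_pairs U.
  by rewrite finset.subUset !finset.sub1set sU.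
rewrite expect_cylinder//; first last.
- rewrite -setI_eq0; apply/eqP/setP => e; rewrite [RHS]inE; apply/negbTE/negP.
  rewrite finset.in_setI => /andP[/set2P[->|->]]; rewrite !inE !eqxx ?andbF/= ?orbF.
    by rewrite [[disjoint t & s]]disjoint_sym dis !andbF.
  by rewrite dis !andbF.
- by rewrite finset.subUset !tS.
rewrite cards2 st ler_pdivlMr ?exprn_gt0//.
have -> : p * (1 - p) ^+ #|touching U s| * (p * (1 - p) ^+ #|touching U t|) =
  p ^+ 2 * (1 - p) ^+ (#|touching U s| + #|touching U t|) by rewrite (exprD (1 - p)) mulrACA.
rewrite -mulrA; apply: ler_wpM2l; first exact: sqr_ge0.
rewrite -(exprD (1 - p)); apply: ler_wiXn2l; rewrite ?(ltW q0)//; first by lra.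
rewrite -cardsUI leq_add2l; apply: card_touchingI_le => //; exact: card2.
Qed.

Definition mean_isolated (R : realFieldType) n (p : R) (U : {set 'I_n}) : R :=
  \sum_(s in inner_pairs U) p * (1 - p) ^+ #|touching U s|.

Lemma isolated_edges_inner n (U : {set 'I_n}) (E : graph n) :
  E \subset inner_pairs U -> isolated_edges U E \subset inner_pairs U.
Proof.
by move=> EU; apply/fintype.subsetP => s; rewrite inE => /and3P[/(fintype.subsetP EU)].
Qed.

Lemma card_isolatedE (R : realFieldType) n (U : {set 'I_n}) (E : graph n) :
  E \subset inner_pairs U ->
  #|isolated_edges U E|%:R = \sum_(s in inner_pairs U) (s \in isolated_edges U E)%:R :> R.
Proof.
move=> /isolated_edges_inner/fintype.subsetP IU.
rewrite -sum1_card natr_sum big_mkcond [RHS]big_mkcond /=; apply: eq_bigr => s _.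
by case: (boolP (s \in isolated_edges U E)) => [/IU->//|_]; rewrite if_same.
Qed.

(** In the second moment the diagonal sums to [mu], and the other terms to at most
    [mu ^+ 2 * (1 - p) ^- 4] by near independence. *)
Lemma isolated_edges_variance_le (R : realFieldType) n (p : R) (U : {set 'I_n}) :
  0 <= p < 1 -> let mu := mean_isolated p U in
  expect p (inner_pairs U) (fun E => (#|isolated_edges U E|%:R - mu) ^+ 2) <=
  mu + mu ^+ 2 * ((1 - p) ^- 4 - 1).
Proof.
move=> p01 /=; set mu := mean_isolated p U; set D := inner_pairs U.
have mean : expect p D (fun E => #|isolated_edges U E|%:R) = mu.
  rewrite (eq_expect p (g := fun E => \sum_(s in D) (s \in isolated_edges U E)%:R)).
    by rewrite expect_sum; apply: eq_bigr => s sD; rewrite isolated_prob.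
  by move=> E ED; rewrite card_isolatedE.
have sq : expect p D (fun E => #|isolated_edges U E|%:R ^+ 2) <= mu + mu ^+ 2 * (1 - p) ^- 4.
  rewrite (eq_expect p (g := fun E => \sum_(s in D) \sum_(t in D)
      ((s \in isolated_edges U E) && (t \in isolated_edges U E))%:R)); last first.
    move=> E ED; rewrite card_isolatedE// expr2 mulr_suml; apply: eq_bigr => s _.
    by rewrite mulr_sumr; apply: eq_bigr => t _; rewrite -natrM mulnb.
  rewrite expect_sum expr2 mulrAC /mu {2}/mean_isolated mulr_suml mulr_suml.
  rewrite {1}/mean_isolated -big_split /=.
  apply: ler_sum => s sD; rewrite expect_sum (bigD1 s)//=; apply: lerD.
    rewrite -(isolated_prob p sD).
    rewrite (eq_expect p (g := fun E => (s \in isolated_edges U E)%:R))//.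
    by move=> E _; rewrite andbb.
  rewrite /mean_isolated mulr_sumr [leRHS](bigD1 s)//=; apply: ler_wpDl.
    by rewrite !mulr_ge0 ?invr_ge0 ?exprn_ge0//; case/andP: p01 => ? ?; lra.
  apply: ler_sum => t /andP[tD ts].
  apply: le_trans (isolated2_prob_le p01 sD tD _) _; first by rewrite eq_sym.
  by rewrite mulrAC.
rewrite (eq_expect p (g := fun E => #|isolated_edges U E|%:R ^+ 2 -
   (2 * mu * #|isolated_edges U E|%:R - mu ^+ 2))); last by move=> E _; ring.
rewrite expectB expectB expectZ expect_cst mean.
have -> : mu + mu ^+ 2 * ((1 - p) ^- 4 - 1) =
  mu + mu ^+ 2 * (1 - p) ^- 4 - (2 * mu * mu - mu ^+ 2) by ring.
by rewrite lerB.
Qed.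

(** Chebyshev's inequality; the deviation exceeds [mu / 2] on the event, whence the factor 4. *)
Lemma few_isolated_prob_le (R : realFieldType) n (p : R) (U : {set 'I_n}) :
  0 <= p < 1 -> let mu := mean_isolated p U in 0 < mu ->
  expect p (inner_pairs U) (fun E => (#|isolated_edges U E|%:R < mu / 2)%R%:R) <=
  4 / mu + 4 * ((1 - p) ^- 4 - 1).
Proof.
move=> p01 /=; set mu := mean_isolated p U => mu0.
apply: (@le_trans _ _ (expect p (inner_pairs U)
    (fun E => 4 / mu ^+ 2 * (#|isolated_edges U E|%:R - mu) ^+ 2))).
  apply: le_expect; first by case/andP: p01 => p0 p1; rewrite p0 ltW.
  move=> E _; move: (#|_|%:R) => x; case: ltP => [x2|_] /=; last first.
    by rewrite mulr_ge0 ?sqr_ge0// divr_ge0// sqr_ge0.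
  by rewrite mulrAC ler_pdivlMr ?exprn_gt0// mul1r; nra.
rewrite expectZ; apply: le_trans (ler_wpM2l _ (isolated_edges_variance_le U p01)) _.
  by rewrite divr_ge0// sqr_ge0.
rewrite le_eqVlt -/mu; apply/orP; left; apply/eqP.
by move: ((1 - p) ^- 4) => q; field; rewrite gt_eqF.
Qed.

(** * Combining the inner and outer exposures *)

Lemma exists_subset_card (T : finType) (A : {set T}) k : (k <= #|A|)%N ->
  exists2 B : {set T}, B \subset A & #|B| = k.
Proof.
move=> kA; exists [set x in take k (enum A)].
  by apply/fintype.subsetP => x; rewrite inE => /mem_take; rewrite mem_enum.
rewrite cardsE; have /card_uniqP-> : uniq (take k (enum A)).
  by rewrite take_uniq// enum_uniq.
by rewrite size_takel// -cardE.
Qed.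

Lemma success_bound_ge0 (R : realFieldType) (p : R) N t : 0 <= p <= 1 ->
  0 <= success_bound p N t.
Proof.
move=> /andP[p0 p1]; rewrite /success_bound /=.
have x0 : 0 <= N%:R * p / (1 + p) by rewrite divr_ge0 ?mulr_ge0//; lra.
have a0 : 0 <= ((1 - p) ^+ 2) ^+ t by rewrite exprn_ge0// sqr_ge0.
have b0 : 0 <= (1 - p ^+ 2) ^+ N by rewrite exprn_ge0//; nra.
by rewrite !mulr_ge0// invr_ge0; lra.
Qed.

Lemma success_bound_le1 (R : realFieldType) (p : R) N t : 0 <= p <= 1 ->
  success_bound p N t <= 1.
Proof.
move=> /andP[p0 p1]; rewrite /success_bound /=.
set x := N%:R * p / (1 + p).
have x0 : 0 <= x by rewrite divr_ge0 ?mulr_ge0//; lra.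
have : 0 <= x / (1 + 4 * x) <= 1.
  apply/andP; split; first by rewrite divr_ge0//; lra.
  by rewrite ler_pdivrMr; lra.
have q1 : 1 - p <= 1 by lra.
have : 0 <= ((1 - p) ^+ 2) ^+ t <= 1.
  by rewrite -exprM exprn_ge0 ?exprn_ile1//; lra.
have : 0 <= (1 - p ^+ 2) ^+ N <= 1.
  by rewrite exprn_ge0 ?exprn_ile1//; nra.
move: (_ ^+ N) (_ ^+ t) (x / _) => a b u /andP[a0 a1] /andP[b0 b1] /andP[u0 u1].
by do 3?[apply: mulr_ile1; rewrite ?mulr_ge0//]; lra.
Qed.

(** Unless there are too few isolated edges, [4 * M <= mu] leaves room for two disjoint families of
    [M] of them, one for each stage of the search. *)
Lemma reconstructible_prob_le (R : realFieldType) n (p : R) (U : {set 'I_n}) (t M : nat) :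
  let N := #|~: U| in let mu := mean_isolated p U in
  0 <= p <= 3^-1 -> 5 * N%:R * p + 2 <= t%:R -> (2 * t <= N)%N ->
  0 < mu -> 4 * M%:R <= mu ->
  expect p (pairs n) (fun E => `[< reconstructible 1 E >]%:R) <=
  4 / mu + 4 * ((1 - p) ^- 4 - 1) + 2 * (1 - success_bound p N t) ^+ M.
Proof.
move=> N mu p03 tN tN2 mu0 Mmu; set D := inner_pairs U.
have p01 : 0 <= p <= 1 by case/andP: p03 => p0 p3; rewrite p0 /=; lra.
have p01' : 0 <= p < 1 by case/andP: p03 => p0 p3; rewrite p0 /=; lra.
set r := success_bound p N t.
have r01 : 0 <= r <= 1 by rewrite success_bound_ge0 ?success_bound_le1.
have DP : D \subset pairs n by apply/fintype.subsetP => e; rewrite inE => /andP[].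
rewrite (expect_split _ _ DP).
apply: le_trans (lerD (few_isolated_prob_le p01' mu0) (lexx _)).
rewrite -(expect_cst p D (2 * _)) -expectD; apply: le_expect => // E1 E1D.
have rM : 0 <= (1 - r) ^+ M by rewrite exprn_ge0// subr_ge0; case/andP: r01.
have [few|many] := ltP (#|isolated_edges U E1|%:R : R) (mu / 2).
  apply: le_trans (_ : 1 <= _); last by rewrite lerDl mulr_ge0.
  rewrite -[leRHS](expect_cst p (pairs n :\: D)); apply: le_expect => // E2 _.
  by case: asbool.
have M2 : (M + M <= #|isolated_edges U E1|)%N.
  by rewrite -(ler_nat R) natrD; lra.
have [I IE IM] := exists_subset_card (leq_trans (leq_addr M M) M2).
have [|J JE JM] := @exists_subset_card _ (isolated_edges U E1 :\: I) M.
  by rewrite cardsD (finset.setIidPr IE) IM leq_subRL// (leq_trans (leq_addr M M)).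
move: JE; rewrite subsetD => /andP[JE JI].
rewrite disjoint_sym in JI.
have := outer_reconstructible_le p03 r01 tN tN2 E1D IE JE JI.
by rewrite IM JM -/r /= add0r mulr2n mulrDl !mul1r.
Qed.

Lemma gnp_probC (R : realType) n (p : R) :
  gnp_prob p (fun G : graph n => ~ reconstructible 1 G) =
  1 - expect p (pairs n) (fun E => `[< reconstructible 1 E >]%:R).
Proof.
rewrite -[X in _ = X - _](expect_cst p (pairs n)) -expectB /gnp_prob /expect.
rewrite big_mkcondr; apply: eq_bigr => E _.
case: (asboolP (~ _)) => H; case: (asboolP (reconstructible _ _)) => H' //.
- by rewrite subr0 mulr1.
- by rewrite subrr mulr0.
Qed.

(** * Sparse and dense regimes *)

Lemma card_inner_pairs n (U : {set 'I_n}) : #|inner_pairs U| = 'C(#|U|, 2).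
Proof.
rewrite -cards_draws; apply: eq_card => e.
by rewrite !inE andbC.
Qed.

(** Bernoulli's inequality. *)
Lemma expr1B_ge (R : realFieldType) (x : R) N : 0 <= x <= 1 ->
  1 - N%:R * x <= (1 - x) ^+ N.
Proof.
move=> /andP[x0 x1]; elim: N => [|N IH]; first by rewrite mul0r subr0 expr0.
rewrite exprSr; apply: le_trans (ler_wpM2r _ IH); last by rewrite subr_ge0.
rewrite -natr1; have : 0 <= N%:R :> R by [].
by move: (N%:R : R) => k; nra.
Qed.

(** There are at least [#|U| ^ 2 / 4] inner pairs, and Bernoulli's inequality with
    [card_touching_le] bounds each isolation factor below by [1 - 2 * #|U| * p], hence by one
    half. *)
Lemma mean_isolated_ge (R : realFieldType) n (p : R) (U : {set 'I_n}) :
  0 <= p <= 1 -> (2 <= #|U|)%N -> 4 * #|U|%:R * p <= 1 ->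
  #|U|%:R ^+ 2 * p / 8 <= mean_isolated p U.
Proof.
move=> /andP[p0 p1] U2 Up; set m := #|U|.
apply: (@le_trans _ _ (\sum_(s in inner_pairs U) p / 2)).
  rewrite sumr_const card_inner_pairs -/m bin2 -[leRHS]mulr_natl.
  have mm : m%:R ^+ 2 <= 4 * (m * m.-1)./2%:R :> R.
    have ev : (m * m.-1 = 2 * (m * m.-1)./2)%N.
      by rewrite mul2n even_halfK//; rewrite oddM; case: (m) => //= k; case: (odd k).
    rewrite -natrX -natrM ler_nat.
    rewrite (_ : 4 * _ = 2 * (m * m.-1))%N; last by rewrite [in RHS]ev mulnA.
    by move: U2; rewrite -/m; case: (m) => // k; rewrite /=; nia.
  by move: (_./2%:R) (m%:R) mm => a b ab; nra.
apply: ler_sum => s; rewrite !inE => /andP[/eqP s2 _].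
apply: ler_wpM2l => //; apply: le_trans (_ : 1 - (2 * m)%:R * p <= _).
  by rewrite natrM; move: Up; rewrite -/m; lra.
apply: le_trans (expr1B_ge _ _) _; first by rewrite p0.
by apply: ler_wiXn2l; [lra|lra|exact: card_touching_le].
Qed.

(** From [(1 - p) ^+ 4 >= 1 - 4 * p], since [(1 + 8 * p) * (1 - 4 * p) >= 1] for [p] up to
    [1 / 8]. *)
Lemma inv_expr4_le (R : realFieldType) (p : R) : 0 <= p <= 8^-1 ->
  (1 - p) ^- 4 - 1 <= 8 * p.
Proof.
move=> /andP[p0 p8]; rewrite lerBlDr.
have := @expr1B_ge _ p 4 _; rewrite p0 /= => /(_ ltac:(lra)) h.
have q0 : 0 < (1 - p) ^+ 4 by rewrite exprn_gt0; lra.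
rewrite -[_^-1]mul1r ler_pdivrMr//.
by move: ((1 - p) ^+ 4) h q0 => q h q0; nra.
Qed.

(** With [M] trials per stage the failure probability is at most [1 / (M * r)], so it is enough to
    have [mu0 * r] large in each regime. *)
Lemma reconstructible_prob_le_of_success (R : realType) n (p mu0 r : R)
    (U : {set 'I_n}) (t : nat) :
  let N := #|~: U| in
  0 <= p <= 8^-1 -> 5 * N%:R * p + 2 <= t%:R -> (2 * t <= N)%N ->
  (2 <= #|U|)%N -> 4 * #|U|%:R * p <= 1 ->
  8 <= mu0 -> mu0 <= #|U|%:R ^+ 2 * p / 8 ->
  0 < r -> r <= success_bound p N t ->
  expect p (pairs n) (fun E => `[< reconstructible 1 E >]%:R) <=
  4 / mu0 + 32 * p + 16 / (mu0 * r).
Proof.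
move=> N p8 tN tN2 U2 Up m8 mU r0 rS.
have m0 : 0 < mu0 by lra.
have /andP[p0 p1] := p8.
have p01 : 0 <= p <= 1 by lra.
have mm := le_trans mU (mean_isolated_ge p01 U2 Up).
have mu_gt0 := lt_le_trans m0 mm.
(* Rounding [mu0 / 4] down loses at most one, hence at most [mu0 / 8] as [mu0 >= 8]. *)
have [M Mlo Mhi] : exists2 M : nat, mu0 / 8 <= M%:R & 4 * M%:R <= mu0.
  exists (Num.truncn (mu0 / 4)); have /truncn_itv/andP[_] : 0 <= mu0 / 4 by lra.
    by rewrite -(natr1 (Num.truncn _)); lra.
  have /truncn_itv/andP[a _] : 0 <= mu0 / 4 by lra.
  by lra.
apply: le_trans (reconstructible_prob_le (t := t) (M := M) _ tN tN2 mu_gt0 _) _.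
- by lra.
- exact: le_trans Mhi mm.
have S1 := success_bound_le1 N t p01.
apply: lerD; first apply: lerD.
- by rewrite ler_pM2l// lef_pV2.
- by have := inv_expr4_le p8; move: ((1 - p) ^- 4) => q; lra.
- have r1 : r <= 1 by apply: le_trans rS S1.
  have -> : 16 / (mu0 * r) = 2 * (8 / (mu0 * r)) by rewrite mulrA; congr (_ / _); ring.
  apply: ler_wpM2l => //.
  apply: (@le_trans _ _ ((1 - r) ^+ M)).
    by apply: lerXn2r; rewrite ?nnegrE ?subr_ge0// lerD2l lerN2.
  apply: le_trans (expr1B_le_inv _ _) _; first by rewrite r1 ltW.
  have -> : 8 / (mu0 * r) = (mu0 / 8 * r)^-1 by field; rewrite !gt_eqF.
  rewrite lef_pV2 ?posrE ?mulr_gt0//; first by nra.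
  by rewrite ltr_wpDr// mulr_ge0// ltW.
Qed.

Lemma card_ord_lt n m : (m <= n)%N -> #|[set i : 'I_n | (i < m)%N]| = m.
Proof.
move=> mn; rewrite -sum1dep_card.
have := @big_ord_widen _ 0%N addn m n (fun=> 1%N) mn.
by rewrite sum1_card card_ord => <-.
Qed.

Lemma ceil_witness (R : realType) (x : R) : 0 <= x ->
  exists2 t : nat, x <= t%:R & t%:R <= x + 1.
Proof.
move=> x0; exists (Num.truncn x).+1; have /andP[a b] := truncn_itv x0.
  exact: ltW.
by rewrite -(natr1 (Num.truncn _)) lerD2r.
Qed.

(** Here [U] is half of the vertices, [t] is bounded, and a trial succeeds with probability of order
    [n p], the chance of an odd count. The last error term tends to zero exactly when [p] is of
    larger order than [n ^ (-3/2)]. *)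
Lemma reconstructible_prob_le_sparse (R : realType) n (p : R) :
  (200 <= n)%N -> 0 < p -> n%:R * p <= 2^-1 -> 320 <= n%:R ^+ 2 * p ->
  expect p (pairs n) (fun E => `[< reconstructible 1 E >]%:R) <=
  160 / (n%:R ^+ 2 * p) + 32 * p + (16 * 40 * 70) / (n%:R ^+ 3 * p ^+ 2).
Proof.
move=> n200 p0 np n2p.
set U := [set i : 'I_n | (i < n./2)%N].
have Uc : #|U| = n./2 by rewrite card_ord_lt//; lia.
have Nc : #|~: U| = (n - n./2)%N by rewrite cardsCs finset.setCK card_ord Uc.
have nR : 200 <= n%:R :> R by rewrite (ler_nat R 200).
have Ulo : n%:R / 2 - 1 <= (n./2)%:R :> R.
  have : n%:R <= (2 * n./2 + 1)%:R :> R by rewrite ler_nat; lia.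
  by rewrite natrD natrM; lra.
have Uhi : (n./2)%:R <= n%:R / 2 :> R.
  have : (2 * n./2)%:R <= n%:R :> R by rewrite ler_nat; lia.
  by rewrite natrM; lra.
have Nlo : n%:R / 2 <= #|~: U|%:R :> R.
  by rewrite Nc natrB; [lra|lia].
have Nhi : #|~: U|%:R <= n%:R :> R by rewrite Nc ler_nat leq_subr.
set N : R := #|~: U|%:R in Nlo Nhi.
have p4 : p <= 400^-1 by nra.
have Np0 : 0 <= 5 * N * p + 2 by rewrite addr_ge0// !mulr_ge0// ltW.
have [t tlo thi] := ceil_witness Np0.
have Np : N * p <= 2^-1 by nra.
have t6 : t%:R <= 6 :> R by lra.
(* [mu0 = n ^ 2 * p / 40] comes from [#|U| ^ 2 >= n ^ 2 / 5]. The success bound is at least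
   [2/5 * 9/20 * n p / 9], which exceeds [r = n p / 70]. *)
have -> : 160 / (n%:R ^+ 2 * p) = 4 / (n%:R ^+ 2 * p / 40) by field; lra.
have -> : 16 * 40 * 70 / (n%:R ^+ 3 * p ^+ 2) =
    16 / (n%:R ^+ 2 * p / 40 * (n%:R * p / 70)) by field; lra.
apply: (reconstructible_prob_le_of_success (U := U) (t := t)) => //.
- by lra.
- have : (t <= 6)%N by rewrite -(ler_nat R).
  by rewrite Nc; move: n200; clear; lia.
- by rewrite Uc; move: n200; clear; lia.
- by rewrite Uc; nra.
- by lra.
- rewrite Uc; move: (n./2%:R) Ulo => m Ulo.
  have : n%:R ^+ 2 / 5 <= m ^+ 2 by nra.
  by move: (m ^+ 2) (n%:R ^+ 2) => a b; nra.
- by nra.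
rewrite /success_bound /= -/N.
set x := N * p / (1 + p).
have x0 : 0 <= x by rewrite /x divr_ge0 ?mulr_ge0//; lra.
have x1 : x <= 2^-1 by rewrite /x ler_pdivrMr; nra.
have xn : n%:R * p / 3 <= x by rewrite /x ler_pdivlMr; nra.
have ux : x / 3 <= x / (1 + 4 * x).
  by apply: ler_wpM2l => //; rewrite lef_pV2 ?posrE; lra.
have a2 : 2^-1 <= ((1 - p) ^+ 2) ^+ t.
  rewrite -exprM; apply: le_trans (expr1B_ge _ _); last by lra.
  by rewrite natrM; nra.
have b2 : 9 / 10 <= (1 - p ^+ 2) ^+ #|~: U|.
  apply: le_trans (expr1B_ge _ _); last by rewrite sqr_ge0; nra.
  by rewrite -/N; nra.
have np9 : n%:R * p / 9 <= x / (1 + 4 * x) by apply: le_trans ux; lra.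
have np0 : 0 <= n%:R * p by rewrite mulr_ge0// ltW.
clear -a2 b2 np9 np0; move: a2 b2 np9 np0.
move: (_ ^+ t) (_ ^+ #|_|) (x / (1 + _)) (n%:R * p) => a b u v a2 b2 np9 np0.
have ab : 9 / 20 <= a * b by nra.
rewrite -[2 / 5 * a * b]mulrA; move: (a * b) ab => c ab.
have : 9 / 20 * u <= c * u by apply: ler_wpM2r => //; lra.
by lra.
Qed.

Lemma expR_le_1B (R : realType) (q : R) : 0 <= q <= 200^-1 ->
  expR (- (101 / 100 * q)) <= 1 - q.
Proof.
move=> /andP[q0 q1]; rewrite expRN -[_^-1]mul1r ler_pdivrMr ?expR_gt0//.
apply: (@le_trans _ _ ((1 - q) * (1 + 101 / 100 * q))); first by nra.
by apply: ler_wpM2l; [lra|exact: expR_ge1Dx].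
Qed.

Lemma expR_le_1B_pow (R : realType) (q : R) k : 0 <= q <= 200^-1 ->
  expR (- (101 / 100 * (k%:R * q))) <= (1 - q) ^+ k.
Proof.
move=> q01; have -> : - (101 / 100 * (k%:R * q)) = k%:R * - (101 / 100 * q) by ring.
rewrite expRM_natl; apply: lerXn2r; rewrite ?nnegrE ?expR_ge0//; last exact: expR_le_1B.
by case/andP: q01 => q0 q1; lra.
Qed.

(** [U] has the largest size allowed by [4 * #|U| * p <= 1], which yields of the order of [1 / p]
    isolated edges. A trial succeeds with probability at least of the order of [n ^ (-45/100)]. *)
Lemma reconstructible_prob_le_dense (R : realType) n (p : R) :
  (200 <= n)%N -> 0 < p -> 2^-1 <= n%:R * p -> 40 * 40 * p <= 1 ->
  25 * (n%:R * p ^+ 2) <= ln n%:R ->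
  expect p (pairs n) (fun E => `[< reconstructible 1 E >]%:R) <=
  10 ^+ 5 * (p * expR (45 / 100 * ln n%:R)).
Proof.
move=> n200 p0 np p16 npL.
have nR : 200 <= n%:R :> R by rewrite (ler_nat R 200).
have pV : 40 * 40 <= p^-1 by rewrite -[p^-1]mul1r ler_pdivlMr.
have pp : p * p^-1 = 1 by rewrite mulfV// gt_eqF.
have pV4 : 0 <= p^-1 / 4 by lra.
set m := Num.truncn (p^-1 / 4).
have [mhi mlo] : m%:R <= p^-1 / 4 /\ p^-1 / 4 - 1 <= m%:R :> R.
  have /andP[a] := truncn_itv pV4; rewrite -(natr1 (Num.truncn _)) -/m in a *.
  by split => //; lra.
have pVn : p^-1 / 2 <= n%:R.
  have pV0 : 0 <= p^-1 by lra.
  by have := ler_wpM2r pV0 np; rewrite mulfK ?gt_eqF//; lra.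
have mn : (m <= n)%N by rewrite -(ler_nat R); lra.
set U := [set i : 'I_n | (i < m)%N].
have Uc : #|U| = m by rewrite card_ord_lt.
have Nc : #|~: U| = (n - m)%N by rewrite cardsCs finset.setCK card_ord Uc.
have Nlo : n%:R / 2 <= #|~: U|%:R :> R by rewrite Nc natrB//; lra.
have Nhi : #|~: U|%:R <= n%:R :> R by rewrite Nc ler_nat leq_subr.
set N : R := #|~: U|%:R in Nlo Nhi.
have Np0 : 0 <= 5 * N * p + 2 by rewrite addr_ge0// !mulr_ge0// ltW.
have [t tlo thi] := ceil_witness Np0.
have Np : N * p <= n%:R * p by rewrite ler_wpM2r// ltW.
have Np4 : 4^-1 <= N * p by nra.
set L := ln n%:R in npL *.
have e0 : 0 < expR (- (45 / 100 * L)) := expR_gt0 _.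
have eL : 1 <= expR (45 / 100 * L).
  by rewrite -[leLHS]expR0 ler_expR mulr_ge0// ln_ge0; lra.
apply: (@le_trans _ _ (4 / (p^-1 / 200) + 32 * p +
    16 / (p^-1 / 200 * (expR (- (45 / 100 * L)) / 25)))); last first.
  rewrite expRN; have f0 := expR_gt0 (45 / 100 * L).
  have -> : 4 / (p^-1 / 200) + 32 * p +
    16 / (p^-1 / 200 * ((expR (45 / 100 * L))^-1 / 25)) =
    832 * p + 16 * 200 * 25 * (p * expR (45 / 100 * L)) by field; rewrite !gt_eqF.
  (* The exponential is at least one, so the constants add up to at most [832 + 80000]. *)
  by move: eL; move: (expR _) => e; nra.
apply: (reconstructible_prob_le_of_success (U := U) (t := t)).
- by lra.
- exact: tlo.
- rewrite -(ler_nat R) natrM -/N.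
  have : n%:R * (40 * 40 * p) <= n%:R * 1 by rewrite ler_wpM2l.
  by lra.
- by rewrite Uc -(ler_nat R); lra.
- rewrite Uc -mulrA; have : m%:R * p <= p^-1 / 4 * p by rewrite ler_wpM2r// ltW.
  by lra.
- by lra.
- rewrite Uc; have m5 : p^-1 / 5 <= m%:R by lra.
  have : p^-1 / 5 * p <= m%:R * p by rewrite ler_wpM2r// ltW.
  by move: (m%:R) (p^-1) pV pp m5 => a b *; nra.
- by lra.
rewrite /success_bound /= -/N.
set x := N * p / (1 + p).
have x4 : 24 / 100 <= x by rewrite /x ler_pdivlMr; lra.
have ux : 12 / 100 <= x / (1 + 4 * x) by rewrite ler_pdivlMr; lra.
have p01 : 0 <= p <= 200^-1 by lra.
have p02 : 0 <= p ^+ 2 <= 200^-1 by rewrite sqr_ge0; nra.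
have a2 := expR_le_1B_pow (2 * t) p01.
have b2 := expR_le_1B_pow #|~: U| p02.
rewrite exprM in a2; rewrite -/N in b2.
(* Avoidance costs [2 t p <= 10 n p ^ 2 + 6 p] in the exponent and lightness at most [n p ^ 2]. The
   main part is at most [11/25 * L], and [11/25 * 101/100 < 45/100]; the term [6 p] is absorbed by
   [1 / 100]. *)
have ab : expR (- (45 / 100 * L)) * (99 / 100) <=
    ((1 - p) ^+ 2) ^+ t * (1 - p ^+ 2) ^+ #|~: U|.
  apply: le_trans (ler_pM (expR_ge0 _) (expR_ge0 _) a2 b2).
  rewrite -expRD.
  apply: (@le_trans _ _ (expR (- (45 / 100 * L) - 1 / 100))); last first.
    rewrite ler_expR natrM.
    have tp : t%:R * p <= (5 * (n%:R * p) + 3) * p by apply: ler_wpM2r; [exact: ltW|lra].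
    have Np2 : N * p ^+ 2 <= n%:R * p ^+ 2 by rewrite ler_wpM2r ?sqr_ge0.
    have L0 : 0 <= L by apply/ln_ge0/(le_trans _ nR); rewrite ler1n.
    have e1 : (5 * (n%:R * p) + 3) * p = 5 * (n%:R * p ^+ 2) + 3 * p by ring.
    rewrite e1 in tp; rewrite -[2 * t%:R * p]mulrA.
    by move: (t%:R * p) (n%:R * p ^+ 2) (N * p ^+ 2) tp Np2 npL => a b c *; lra.
  rewrite expRD ler_wpM2l ?expR_ge0//.
  by apply: le_trans (expR_ge1Dx _); lra.
rewrite -[2 / 5 * _ * _]mulrA.
move: ab ux; move: (_ * _ ^+ #|_|) (x / (1 + _)) (expR _) e0 => c u e *.
have : 12 / 100 * c <= u * c by apply: ler_wpM2r => //; nra.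
by nra.
Qed.

(** By the upper bound on [p] the square is at most [L / 25] times [n ^ (-1/10)], and the quadratic
    term of the exponential series gives [n ^ (1/10) >= L ^ 2 / 200]. *)
Lemma dense_error_small (R : realType) n (p : R) : (1 < n)%N ->
  25 * (n%:R * p ^+ 2) <= ln n%:R ->
  (p * expR (45 / 100 * ln n%:R)) ^+ 2 <= 8 / ln n%:R.
Proof.
move=> n1; set L := ln n%:R => npL.
have L0 : 0 < L by rewrite ln_gt0// (ltr_nat R 1).
have nE : n%:R = expR L by rewrite lnK// posrE ltr0n; lia.
have ge : L ^+ 2 / 200 <= expR (1 / 10 * L).
  have := @expR_ge1Dxn R (1 / 10 * L) 1 ltac:(lra).
  rewrite (_ : 2`!%:R = 2)// exprMn => h.
  by move: h; move: (expR _) (L ^+ 2) => e l h; lra.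
rewrite ler_pdivlMr// exprMn -expRM_natl.
have -> : 2 * (45 / 100 * L) = L - 1 / 10 * L by lra.
rewrite expRD -nE expRN.
rewrite (_ : p ^+ 2 * _ * L = n%:R * p ^+ 2 * L / expR (1 / 10 * L)); last by ring.
rewrite ler_pdivrMr ?expR_gt0//.
have : n%:R * p ^+ 2 * L <= L / 25 * L by apply: ler_wpM2r; [exact: ltW|lra].
rewrite (_ : L / 25 * L = L ^+ 2 / 25); last by ring.
by move: (expR _) (L ^+ 2) (_ * _ * L) ge => e l k *; lra.
Qed.

(** * Passage to the limit *)

Lemma ln_nat_ge (R : realType) (b : R) : \forall n \near \oo%classic, b <= ln n%:R.
Proof.
near=> n.
have nb : expR b <= n%:R by near: n; exact: nbhs_infty_ger.
by rewrite -ler_expR lnK// posrE; apply: lt_le_trans nb; exact: expR_gt0.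
Unshelve. all: by end_near. Qed.

(** The regimes meet at [n p = 1 / 2]. The quantity [z], which is [p n ^ (45/100)], controls the
    dense error and the term [32 * p]; in the sparse regime the other two terms are at most
    constants over [y = p n ^ (3/2)]. *)
Lemma reconstructible_prob_le_small (R : realType) n (p eps : R) :
  0 < eps <= 1 -> 0 <= p -> (200 <= n)%N ->
  10 ^+ 5 / eps <= p * (n%:R * Num.sqrt n%:R) ->
  p <= Num.sqrt (ln n%:R / (25 * n%:R)) ->
  8 / (eps / 10 ^+ 6) ^+ 2 <= ln n%:R ->
  expect p (pairs n) (fun E => `[< reconstructible 1 E >]%:R) <= eps.
Proof.
move=> /andP[e0 e1] p_ge0 n200 pn psqrt Lbig.
have nR : 200 <= n%:R :> R by rewrite (ler_nat R 200).
have L0 : 0 < ln n%:R :> R by rewrite ln_gt0; lra.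
have pos : 0 < 10 ^+ 5 / eps by rewrite divr_gt0.
have p0 : 0 < p.
  by rewrite lt_neqAle p_ge0 andbT; apply: contraTneq (lt_le_trans pos pn) => <-;
    rewrite mul0r ltxx.
have npL : 25 * (n%:R * p ^+ 2) <= ln n%:R.
  have : p ^+ 2 <= ln n%:R / (25 * n%:R).
    have d0 : 0 <= ln n%:R / (25 * n%:R) :> R by rewrite divr_ge0 ?ltW//; lra.
    by rewrite -(sqr_sqrtr d0) ler_sqr ?nnegrE ?sqrtr_ge0.
  by rewrite ler_pdivlMr; lra.
set z := p * expR (45 / 100 * ln n%:R).
have z0 : 0 < z by rewrite mulr_gt0// expR_gt0.
have zsmall : z <= eps / 10 ^+ 6.
  have d0 : 0 < eps / 10 ^+ 6 by lra.
  rewrite -ler_sqr ?nnegrE; [|exact: ltW|exact: ltW].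
  apply: le_trans (dense_error_small (leq_trans _ n200) npL) _; first by [].
  rewrite ler_pdivrMr//.
  by move: Lbig; rewrite ler_pdivrMr ?exprn_gt0// mulrC.
have pz : p <= z.
  by rewrite /z ler_peMr// -[leLHS]expR0 ler_expR mulr_ge0// ltW.
have [np|np] := leP (n%:R * p) (2^-1); last first.
  apply: le_trans (reconstructible_prob_le_dense n200 p0 (ltW np) _ npL) _.
    by lra.
  by rewrite -/z; lra.
set y := p * (n%:R * Num.sqrt n%:R) in pn.
have y9 : 10 ^+ 5 <= y.
  by apply: le_trans pn; rewrite ler_pdivlMr//; lra.
have s1 : 1 <= Num.sqrt n%:R :> R by rewrite -[leLHS]sqrtr1 ler_sqrt; lra.
have ss : Num.sqrt n%:R ^+ 2 = n%:R :> R by rewrite sqr_sqrtr; lra.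
have n2 : y <= n%:R ^+ 2 * p.
  have -> : n%:R ^+ 2 * p = y * Num.sqrt n%:R.
    have H (a s : R) : s ^+ 2 = a -> a ^+ 2 * p = p * (a * s) * s by move=> <-; ring.
    exact: H.
  by rewrite ler_peMr//; lra.
have n3 : y ^+ 2 = n%:R ^+ 3 * p ^+ 2.
  by rewrite /y !exprMn ss; ring.
apply: le_trans (reconstructible_prob_le_sparse n200 p0 np _) _; first by lra.
rewrite -n3.
have y0 : 0 < y by lra.
have b1 : 160 / (n%:R ^+ 2 * p) <= 160 / y.
  by rewrite ler_pM2l// lef_pV2 ?posrE//; lra.
have b2 : 16 * 40 * 70 / y ^+ 2 <= 16 * 40 * 70 / y.
  by rewrite ler_pM2l// lef_pV2 ?posrE ?exprn_gt0//; nra.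
have b3 : y^-1 <= eps / 10 ^+ 5.
  rewrite -[_ / _]invrK lef_pV2 ?posrE ?invr_gt0 ?divr_gt0//.
  by rewrite invf_div.
apply: le_trans (lerD (lerD b1 (lexx _)) b2) _.
by move: b3 pz zsmall e0; clear; move: y^-1 => v; lra.
Qed.

Local Open Scope classical_set_scope.

Theorem theorem1p6 (R : realType) (p : nat -> R) :
  (forall n, 0 <= p n <= 1) ->
  (fun n : nat => p n * (n%:R * Num.sqrt n%:R)) @ \oo --> +oo ->
  (\forall n \near \oo, p n <= Num.sqrt (ln n%:R / (25 * n%:R))) ->
  (fun n : nat => gnp_prob (p n) (fun G : graph n => ~ reconstructible 1 G))
    @ \oo --> (1 : R).
Proof.
move=> p01 /cvgryPge py pu; apply/cvgrPdist_le => e e0.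
(* The error is capped at one, as the preceding estimate demands. *)
have eps01 : 0 < Num.min e 1 <= 1 by rewrite lt_min e0 ltr01 ge_min lexx orbT.
near=> n.
rewrite gnp_probC opprB addrCA subrr addr0 ger0_norm; last first.
  rewrite -[leLHS](expect_cst (p n) (pairs n)); apply: le_expect; first exact: p01.
  by move=> E _; case: asbool.
apply: (@le_trans _ _ (Num.min e 1)); last by rewrite ge_min lexx.
apply: reconstructible_prob_le_small => //.
- by case/andP: (p01 n).
- by near: n; exact: nbhs_infty_ge.
- by near: n; exact: py.
- by near: n.
- by near: n; exact: ln_nat_ge.
Unshelve. all: by end_near. Qed.
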